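(* Let $G$ be a Carnot group with step $s$, homogeneous dimension $Q$, $n=\dim V_1$, let $p\in[1,\infty]$ and let $f\in L^1_{\mathrm{loc}}(G)$. (i) If $1\le p<\frac{Q}{Q-1}$, $\int_G |f|(1+|x|_R)\,dx<\infty$ and $|x|_Rf,\ |x|_R^2 f\in L^p(G)$, then there exist functions $F_{ij}\in L^p(G)$ ($1\le i,j\le N$) and $F_i\in L^p(G)$ ($n+1\le i\le N$) such that, in the sense of distributions, $$f=\Big(\int_G f\,dx\Big)\delta_0-\sum_{i=1}^n\Big(\int_G f(x)\,x_i\,dx\Big)X^i\delta_0+\sum_{i,j=1}^N X^iX^j(F_{ij})+\sum_{i=n+1}^N X^i(F_i).$$ (ii) If $Q>2s$, $p>\frac{Q}{Q-2s}$ and $|x|_Rf,\ |x|_R^2f\in L^p(G)$, then there exist $F_{ij}\in L^p(G)$ ($1\le i,j\le N$) and $F_i\in L^p(G)$ ($n+1\le i\le N$) such that, in the sense of distributions, $$f=\sum_{i,j=1}^N X^iX^j(F_{ij})+\sum_{i=n+1}^N X^i(F_i).$$ In both cases these functions can be chosen with $\|F_{ij}\|_{L^p}\le C\,\||x|_R^2 f\|_{L^p}$ and $\|F_i\|_{L^p}\le C\,\||x|_R f\|_{L^p}$, where $C$ depends only on $p$ and $G$.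
   Context: A Carnot group $G$ is a connected, simply connected nilpotent Lie group whose Lie algebra $\mathfrak g$ carries a stratification $\mathfrak g=V_1\oplus\cdots\oplus V_s$ with $[V_1,V_i]=V_{i+1}$ for $1\le i<s$, $[V_1,V_s]=0$, $V_s\neq0$ ($s$ is the step), together with an inner product on $V_1$. Fix a basis $X^1,\dots,X^N$ of $\mathfrak g$ adapted to the stratification and ordered by increasing layer (each $X^i$ lies in some layer $V_{w^i}$; $w^i$ is its weight), with $X^1,\dots,X^n$ an orthonormal basis of $V_1$, so $w^i=1$ iff $i\le n$. Identify $G$ with $\mathbb R^N$ through exponential coordinates $x=(x_1,\dots,x_N)\leftrightarrow\exp(\sum_i x_iX^i)$; each $X^i$ is regarded as a left-invariant vector field on $G$. The Haar measure $dx$ is Lebesgue measure in these coordinates and $L^p(G)$ is taken with respect to it. Dilations: $\Gamma_r(x)=(r^{w^1}x_1,\dots,r^{w^N}x_N)$; homogeneous dimension $Q=\sum_i w^i$. Here $|x|_R=(\sum_{i=1}^N x_i^2)^{1/2}$. $\delta_0$ is the Dirac mass at the identity $0$. Distributional derivatives: the $X^i$ are skew-adjoint with respect to $dx$, and for a distribution $T$ one sets $\langle X^iT,\phi\rangle=-\langle T,X^i\phi\rangle$ for $\phi\in C_c^\infty(G)$; in particular $\langle X^i\delta_0,\phi\rangle=-(X^i\phi)(0)$. *)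

(* Defs.v *)
From HB Require Import structures.
From mathcomp Require Import all_boot all_order all_algebra.
From mathcomp Require Import all_classical all_reals all_analysis.
Set Implicit Arguments. Unset Strict Implicit. Unset Printing Implicit Defensive.
Import Order.TTheory GRing.Theory Num.Theory.
Import numFieldNormedType.Exports.
Local Open Scope classical_set_scope.
Local Open Scope ring_scope.

(* Carnot groups in exponential coordinates.                           *)
(* The Lie algebra g = R^N with basis X^0..X^(N-1) (0-indexed here),    *)
(* bracket [X^i, X^j] = sum_k c i j k X^k, weights w i (layer of X^i),  *)
(* X^0..X^(n-1) the (orthonormal) basis of V_1.                         *)
Record carnot (R : realType) := Carnot {
  cN : nat;
  cn : nat;
  cs : nat;
  cw : 'I_cN -> nat;
  cc : 'I_cN -> 'I_cN -> 'I_cN -> R;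
  cs_gt0 : (0 < cs)%N;
  cw_range : forall i, (1 <= cw i <= cs)%N;
  cw_mono : forall i j : 'I_cN, (i <= j)%N -> (cw i <= cw j)%N;
  cw_V1 : forall i : 'I_cN, (cw i == 1)%N = (i < cn)%N;
  cVs_neq0 : exists i, cw i = cs;
  cc_antisym : forall i j k, cc i j k = - cc j i k;
  cc_jacobi : forall i j l m,
    \sum_k (cc i j k * cc k l m + cc j l k * cc k i m + cc l i k * cc k j m) = 0;
  cc_graded : forall i j k, cc i j k != 0 -> cw k = (cw i + cw j)%N;
  (* stratification: V_(l+1) <= [V_1, V_l]  (the reverse inclusion is the
     grading), for 1 <= l < s; [V_1,V_s] = 0 follows from grading + cw <= cs *)
  cc_strat : forall k : 'I_cN, (1 < cw k)%N ->
    exists a : 'I_cN -> 'I_cN -> R,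
      forall m : 'I_cN,
        (k == m)%:R = \sum_(i | (cw i == 1)%N) \sum_(j | (cw j == (cw k).-1)%N)
                          a i j * cc i j m
}.

Section CarnotDefs.
Variable R : realType.
Variable G : carnot R.
Local Notation N := (cN G).

Definition pt := 'rV[R]_N.

Definition homdim : nat := (\sum_(i < N) cw i)%N.

Definition lbr (x y : pt) : pt :=
  \row_k \sum_i \sum_j x ord0 i * y ord0 j * cc i j k.

(* Bernoulli numbers (B_1 = -1/2 convention) *)
Fixpoint bernl (m : nat) : seq R :=
  match m with
  | 0 => [:: 1]
  | m'.+1 => let l := bernl m' in
      rcons l (- (m'.+2%:R)^-1 * \sum_(j < m'.+1) 'C(m'.+2, j)%:R * nth 0 l j)
  end.
Definition bern (m : nat) : R := nth 0 (bernl m) m.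

(* coefficients of ad/(1 - e^{-ad}) = sum_k bcoef k ad^k *)
Definition bcoef (k : nat) : R :=
  if k == 1%N then 2^-1 else bern k / (k`!)%:R.

Definition ebasis (i : 'I_N) : pt := delta_mx 0 i.

(* Value at the point x of the left-invariant vector field X^i, in
   exponential coordinates: d/dt log(exp(x) exp(t X^i)) at t = 0,
   i.e. (ad_x / (1 - e^{-ad_x})) X^i (ad_x is nilpotent of order <= s). *)
Definition lvf (i : 'I_N) (x : pt) : pt :=
  \sum_(k < cs G) bcoef k *: iter k (lbr x) (ebasis i).

Definition Xop (i : 'I_N) (phi : pt -> R) : pt -> R :=
  fun x => derive phi x (lvf i x).

Definition normR (x : pt) : R := Num.sqrt (\sum_i x ord0 i ^+ 2).

Fixpoint smoothk (k : nat) (phi : pt -> R) : Prop :=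
  match k with
  | 0 => continuous phi
  | k'.+1 => (forall x, differentiable phi x) /\
             forall i, smoothk k' (fun x => derive phi x (ebasis i))
  end.
Definition test_fun (phi : pt -> R) : Prop :=
  (forall k, smoothk k phi) /\ compact (closure [set x | phi x != 0]).

Definition rmeas (f : pt -> R) : Prop :=
  measurable_fun [set: N.-tuple R] (fun t => f (\row_i tnth t i)).

(* iterated Lebesgue integral of a nonnegative function on R^m
   (equal, by Tonelli, to the integral against Lebesgue measure on R^m
    for measurable nonnegative functions) *)
Fixpoint iint (m : nat) : ('rV[R]_m -> \bar R) -> \bar R :=
  match m return ('rV[R]_m -> \bar R) -> \bar R with
  | 0 => fun f => f 0
  | m'.+1 => fun f => (\int[lebesgue_measure]_t
                         iint (fun y : 'rV[R]_m' => f (row_mx (\row__ (t : R) : 'rV[R]_1) y)))%E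
  end.

Definition nnint (f : pt -> \bar R) : \bar R := iint f.

(* Lebesgue integral of a real function (meaningful for integrable f) *)
Definition intN (f : pt -> R) : R :=
  fine (nnint (fun x => (Num.max (f x) 0)%:E)) -
  fine (nnint (fun x => (Num.max (- f x) 0)%:E)).

Definition loc_int (f : pt -> R) : Prop :=
  rmeas f /\ forall K : set pt, compact K ->
    (nnint (fun x => (\1_K x * `|f x|)%:E) < +oo)%E.

Definition esssupN (f : pt -> R) : \bar R :=
  ereal_inf [set M : \bar R |
     nnint (fun x => ((M < (`|f x|)%:E)%E)%:R%:E) = 0%E].

Definition LpN (p : \bar R) (f : pt -> R) : \bar R :=
  match p with
  | r%:E => poweR (nnint (fun x => (powR `|f x| r)%:E)) r^-1
  | +oo%E => esssupN f
  | -oo%E => 0%E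
  end.

Definition inLp (p : \bar R) (f : pt -> R) : Prop :=
  rmeas f /\ (LpN p f < +oo)%E.

End CarnotDefs.

(* Main.v *)
Require Import Defs.
From HB Require Import structures.
From mathcomp Require Import all_boot all_order all_algebra.
From mathcomp Require Import all_classical all_reals all_analysis.
From mathcomp Require Import measurable_realfun ring lra.
Set Implicit Arguments. Unset Strict Implicit. Unset Printing Implicit Defensive.
Import Order.TTheory GRing.Theory Num.Theory.
Import numFieldNormedType.Exports.
Local Open Scope classical_set_scope.
Local Open Scope ring_scope.

(** In exponential coordinates the field [sum_i x_i X^i] has value [x] at every
    point [t x], because [ad_x x = 0]; hence [d/dt phi(t x) = sum_i x_i (X^i phi)(t x)].
    Integrating over [0 < t < 1] gives a Taylor expansion of [phi] at the origin, with
    remainders [int_0^1 (X^i phi)(t x) dt] for [i > n] and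
    [int_0^1 (1 - t) (X^j X^i phi)(t x) dt] for [i <= n]; integrating twice over [t > 1]
    gives [phi(x) = sum_ij x_i x_j int_1^oo (t - 1) (X^j X^i phi)(t x) dt].
    Multiplying by [f] and substituting [y = t x], the adjoint operators are
    [g |-> int k(t) t^-N g(y / t) dt], and Minkowski's inequality bounds them on [L^p] by
    [int k(t) t^(-N + N/p) dt].  So only isotropic dilations are needed: as
    [N <= Q <= s N], the hypotheses on [p] imply [N - N/p < 1] in case (i) and
    [N - N/p > 2] in case (ii), which makes these constants finite. In case (ii) all
    the [F_i] can even be taken to be [0]. *)

(** * Lebesgue measure on tuples *)

(** The statement speaks of iterated integrals and of differences of [fine] values, which obey
    neither linearity nor Fubini until they are identified with integrals against one measure and
    integrability is known. Hence the measure [muN], and later the predicate [has_int], which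
    carries integrability along with the value. The integrability of [f phi] is itself read off from
    the expansion: each remainder term is integrable by duality, and the polynomial terms of case
    (i) are integrable by the weighted [L^1] bound.

    The duality is an exchange of integrals, so the average of [|g|] must be integrable against
    compactly supported functions; the [L^p] bound supplies this.

    Where the expansion stops is dictated by the conclusion. Derivatives of the Dirac mass occur
    only for i <= n, so only those first-order terms are expanded to second order; the others stay
    as first-order remainders and become the [F_i]. The thresholds come from the kernels: 1 and 1 -
    t are bounded near 0, so t^(-N+N/p) has to be integrable on (0, 1], while t - 1 grows like t,
    which costs one more power at infinity. *)

Section tuple_measure_step.
Context (R : realType) (m : nat).
Variable mu : {sigma_finite_measure set (m.-tuple R) -> \bar R}.
Local Notation TR := (measurableTypeR R).

Definition cons_pair (p : TR * m.-tuple R) : m.+1.-tuple R :=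
  [tuple of (p.1 : R) :: p.2].

Lemma measurable_cons_pair : measurable_fun setT cons_pair.
Proof.
apply: (@measurable_cons _ _ (TR * m.-tuple R)%type R (fun p => p.1 : R) m snd) => //.
exact: measurable_fst.
Qed.

Definition uncons (t : m.+1.-tuple R) : TR * m.-tuple R :=
  (tnth t ord0, [tuple of behead t]).

Lemma measurable_uncons : measurable_fun setT uncons.
Proof.
apply: measurable_fun_pair.
  exact: (@measurable_tnth _ R m.+1 ord0).
exact: measurable_behead.
Qed.

Lemma cons_pairK : cancel cons_pair uncons.
Proof. by case=> a t; congr (_, _); apply: val_inj. Qed.

Local Open Scope ereal_scope.

(** The image of a product measure under [cons_pair], so that Tonelli unfolds its integrals in the
    order of the recursion of [iint]. Sigma-finiteness is carried along because the next product
    needs it. *)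
Definition cons_measure : set (m.+1.-tuple R) -> \bar R :=
  pushforward (@lebesgue_measure R \x mu) cons_pair.

Let pm : {measure set (TR * m.-tuple R)%type -> \bar R} :=
  @lebesgue_measure R \x mu.

Let cons_measure0 : cons_measure set0 = 0.
Proof. by rewrite /cons_measure /pushforward preimage_set0 measure0. Qed.

Let cons_measure_ge0 A : 0 <= cons_measure A.
Proof. exact: (measure_ge0 pm). Qed.

Let mpre A : measurable A -> measurable (cons_pair @^-1` A).
Proof. by move=> mA; rewrite -[X in measurable X]setTI; exact: measurable_cons_pair. Qed.

Let cons_measure_sigma_additive : semi_sigma_additive cons_measure.
Proof.
move=> F mF tF mUF; rewrite /cons_measure /pushforward preimage_bigcup.
apply: (@measure_semi_sigma_additive _ _ _ pm).
- by move=> n; exact: mpre.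
- apply/trivIsetP => /= i j _ _ ij; rewrite -preimage_setI.
  by move/trivIsetP : tF => /(_ _ _ _ _ ij) ->//; rewrite preimage_set0.
- by rewrite -preimage_bigcup; exact: mpre.
Qed.

HB.instance Definition _ := isMeasure.Build _ _ _ cons_measure
  cons_measure0 cons_measure_ge0 cons_measure_sigma_additive.

Let cons_measure_sigma_finite : sigma_finite setT cons_measure.
Proof.
have /sigma_finiteP[F [TF ndF Foo]] := sigma_finiteT (@lebesgue_measure R).
have /sigma_finiteP[G [TG ndG Goo]] := sigma_finiteT mu.
exists (fun n => uncons @^-1` (F n `*` G n)).
  rewrite -preimage_bigcup (_ : \bigcup_n _ = setT) ?preimage_setT//.
  rewrite -setXTT TF TG predeqE => -[x y]; split; first by move=> [n _ [/= ? ?]]; split; exists n.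
  (* Both exhausting sequences are nondecreasing, so one index serves both coordinates. *)
  move=> [/= [n _ Fnx] [k _ Gky]]; exists (maxn n k) => //; split.
    by move: x Fnx; exact/subsetPset/ndF/leq_maxl.
  by move: y Gky; exact/subsetPset/ndG/leq_maxr.
move=> n; have [mF Fn] := Foo n; have [mG Gn] := Goo n; split.
  rewrite -[X in measurable X]setTI; apply: measurable_uncons => //.
  exact: measurableX.
rewrite /cons_measure /pushforward -comp_preimage.
rewrite (_ : uncons \o _ = id); last by apply/funext => x /=; rewrite cons_pairK.
by rewrite preimage_id /= product_measure1E// lte_mul_pinfty// ge0_fin_numE.
Qed.

HB.instance Definition _ := Measure_isSigmaFinite.Build _ _ _ cons_measure
  cons_measure_sigma_finite.

Definition cons_smeasure : {sigma_finite_measure set (m.+1.-tuple R) -> \bar R} :=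
  cons_measure.

Lemma ge0_integral_cons_measure (f : m.+1.-tuple R -> \bar R) :
  measurable_fun setT f -> (forall x, 0 <= f x) ->
  \int[cons_smeasure]_x f x =
  \int[lebesgue_measure]_t \int[mu]_y f (cons_pair (t, y)).
Proof.
move=> mf f0.
transitivity (\int[pm]_x (f \o cons_pair) x).
  apply: (@ge0_integral_pushforward _ _ _ _ _ cons_pair measurable_cons_pair pm setT) => //.
rewrite fubini_tonelli1 //=.
by apply: measurableT_comp => //; exact: measurable_cons_pair.
Qed.

End tuple_measure_step.

Section tuple_measure.
Context (R : realType).
Local Notation TR := (measurableTypeR R).
Local Open Scope ereal_scope.

Fixpoint muN (m : nat) : {sigma_finite_measure set (m.-tuple R) -> \bar R} :=
  match m with
  | 0 => dirac ([tuple] : 0.-tuple R)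
  | m'.+1 => cons_smeasure (muN m')
  end.

Definition rowt m (t : m.-tuple R) : 'rV[R]_m := \row_i tnth t i.

Lemma rowt_cons m (a : R) (t : m.-tuple R) :
  rowt (cons_pair (a, t)) = row_mx (\row__ (a : R) : 'rV[R]_1) (rowt t).
Proof.
apply/rowP => i; rewrite !mxE; case: splitP => j.
  by rewrite ord1 /= => i0; rewrite mxE (_ : i = ord0)//; apply: val_inj.
move=> /= ij; rewrite mxE (_ : i = lift ord0 j) ?tnthS//.
by apply: val_inj.
Qed.

Lemma measurable_tuple_slice m (f : m.+1.-tuple R -> \bar R) (t : R) :
  measurable_fun setT f -> measurable_fun setT (fun y => f (cons_pair (t, y))).
Proof.
move=> mf; apply: (measurableT_comp mf).
exact: (measurableT_comp (@measurable_cons_pair R m) (measurable_pair1 (t : TR))).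
Qed.

(** The bridge from the iterated integrals of the statement to a single sigma-finite measure, where
    Tonelli, Hölder and changes of variables apply. *)
Lemma iintE m (f : 'rV[R]_m -> \bar R) :
  measurable_fun setT (f \o @rowt m) -> (forall x, 0 <= f x) ->
  iint f = \int[muN m]_t f (rowt t).
Proof.
elim: m f => [|m IH] f mf f0 /=.
  rewrite integral_dirac//= diracE mem_set// mul1e.
  by congr f; apply/rowP => -[].
rewrite (ge0_integral_cons_measure _ mf); last by move=> x; exact: f0.
apply: eq_integral => t _; rewrite IH//.
  by apply: eq_integral => y _ /=; rewrite rowt_cons.
rewrite (_ : _ \o _ = fun y => (f \o @rowt m.+1) (cons_pair (t, y))).
  exact: measurable_tuple_slice.
by apply/funext => y /=; rewrite rowt_cons.
Qed.

Definition tscale m (s : R) (t : m.-tuple R) : m.-tuple R :=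
  [tuple (s * tnth t i)%R | i < m].

Lemma rowt_tscale m s (t : m.-tuple R) : rowt (tscale s t) = (s *: rowt t)%R.
Proof. by apply/rowP => i; rewrite !mxE tnth_mktuple. Qed.

Lemma tscale_cons m s (a : R) (t : m.-tuple R) :
  tscale s (cons_pair (a, t)) = cons_pair ((s * a)%R, tscale s t).
Proof.
apply: eq_from_tnth => i; rewrite tnth_mktuple.
by case: (unliftP ord0 i) => [j ->|->//]; rewrite !tnthS tnth_mktuple.
Qed.

Lemma measurable_tscale_pair m :
  measurable_fun setT (fun p : TR * m.-tuple R => tscale p.1 p.2).
Proof.
apply/measurable_fun_tnthP => i.
rewrite (_ : _ \o _ = fun p => ((p.1 : R) * tnth p.2 i)%R); last first.
  by apply/funext => p /=; rewrite tnth_mktuple.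
apply: measurable_funM; first exact: measurable_fst.
exact: (measurableT_comp (measurable_tnth i)).
Qed.

Lemma measurable_tscale m (s : R) : measurable_fun setT (@tscale m s).
Proof.
exact: (measurableT_comp (@measurable_tscale_pair m) (measurable_pair1 (s : TR))).
Qed.

(** By uniqueness of Lebesgue measure: the rescaled image measure gives half-open intervals their
    length. *)
Lemma lebesgue_measure_scale (s : R) (A : set TR) : (0 < s)%R -> measurable A ->
  s%:E * pushforward lebesgue_measure (fun x : TR => (s * x)%R : TR) A =
  lebesgue_measure A.
Proof.
move=> s0 mA.
have ms : measurable_fun setT (fun x : TR => (s * x)%R : TR).
  exact: (@mulrl_measurable R setT s).
pose k : {nonneg R} := NngNum (ltW s0).
pose pf := measure_function_pushforward__canonical__measure_function_Measure
  (@lebesgue_measure R) ms.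
apply/esym/(@lebesgue_measure_unique R (mscale k pf)) => //= _ [[a b]] _ <-.
rewrite /mscale /= /pushforward (_ : _ @^-1` _ = `](s^-1 * a)%R, (s^-1 * b)%R]%classic).
  rewrite !lebesgue_measure_itv/= !lte_fin ltr_pM2l ?invr_gt0//.
  by case: ifPn => _; rewrite ?mule0// -!EFinB -EFinM -mulrBr mulVKf ?gt_eqF.
by apply/seteqP; split => x /=; rewrite !in_itv/= ltr_pdivrMl// ler_pdivlMl.
Qed.

Lemma ge0_integral_scale (s : R) (f : R -> \bar R) : (0 < s)%R ->
  measurable_fun setT f -> (forall x, 0 <= f x) ->
  \int[lebesgue_measure]_x f (s * x)%R = s^-1%:E * \int[lebesgue_measure]_x f x.
Proof.
move=> s0 mf f0.
have ms : measurable_fun setT (fun x : TR => (s * x)%R : TR).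
  exact: (@mulrl_measurable R setT s).
pose k : {nonneg R} := NngNum (ltW s0).
transitivity (s^-1%:E * (s%:E * \int[lebesgue_measure]_x f (s * x)%R)).
  by rewrite muleA -EFinM mulVf ?gt_eqF// mul1e.
congr (_ * _).
pose pf := measure_function_pushforward__canonical__measure_function_Measure
  (@lebesgue_measure R) ms.
transitivity (k%:num%:E * \int[pf]_x f x).
  congr (_ * _); apply/esym.
  exact: (@ge0_integral_pushforward _ _ TR TR R _ ms lebesgue_measure setT f).
rewrite -(@ge0_integral_mscale _ TR R pf setT measurableT k f)//.
by apply: eq_measure_integral => A mA _; exact: lebesgue_measure_scale.
Qed.

Lemma ge0_integral_tscale m (s : R) (f : m.-tuple R -> \bar R) : (0 < s)%R ->
  measurable_fun setT f -> (forall x, 0 <= f x) ->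
  \int[muN m]_x f (tscale s x) = (s^-1 ^+ m)%:E * \int[muN m]_x f x.
Proof.
move=> s0; elim: m f => [|m IH] f mf f0.
  rewrite !integral_dirac//=.
    by rewrite expr0 mul1e (_ : tscale s _ = [tuple])//; apply: val_inj; case: (tscale _ _) => -[].
  by apply: (measurableT_comp mf); exact: measurable_tscale.
have mft : measurable_fun setT (fun x => f (tscale s x)).
  by apply: (measurableT_comp mf); exact: measurable_tscale.
rewrite !ge0_integral_cons_measure//=.
have sm0 : 0 <= (s^-1 ^+ m)%:E by rewrite lee_fin exprn_ge0// invr_ge0 ltW.
transitivity (\int[lebesgue_measure]_t ((s^-1 ^+ m)%:E *
    \int[muN m]_y f (cons_pair ((s * t)%R, y)))).
  apply: eq_integral => t _.
  rewrite -(IH (fun y => f (cons_pair ((s * t)%R, y))))//.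
    by apply: eq_integral => y _; rewrite tscale_cons.
  exact: measurable_tuple_slice.
have mI : measurable_fun setT (fun t : TR => \int[muN m]_y f (cons_pair (t, y))).
  apply: (measurable_fun_fubini_tonelli_F (f \o @cons_pair R m)) => //=.
  by apply: (measurableT_comp mf); exact: measurable_cons_pair.
have I0 (t : R) : 0 <= \int[muN m]_y f (cons_pair (t, y)).
  by apply: integral_ge0.
rewrite ge0_integralZl//; last first.
  by apply: (measurableT_comp mI); exact: (@mulrl_measurable R setT s).
rewrite (@ge0_integral_scale s (fun t => \int[muN m]_y f (cons_pair (t, y))))//.
by rewrite muleA -EFinM exprSr.
Qed.

End tuple_measure.

(** * Taylor formulas with integral remainder *)

Section weighted_integrals.
Context (R : realType).
Local Notation mu := (@lebesgue_measure R).
Implicit Types (w h u du ddu : R -> R) (D : set R).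

Definition wint (k h : R -> R) : R := \int[mu]_t (k t * h t).

Lemma restrictM w h D : (fun t => (w \_ D) t * h t) = (fun t => w t * h t) \_ D.
Proof. by apply/funext => t; rewrite !patchE; case: ifPn => // _; rewrite mul0r. Qed.

Lemma integrable_segment w h (a b : R) : continuous w -> continuous h ->
  mu.-integrable `[a, b] (fun t => (w t * h t)%:E).
Proof.
move=> cw ch; apply: (@continuous_compact_integrable R (fun t => w t * h t)).
  exact: segment_compact.
by apply: continuous_subspaceT => t; apply: continuousM; [exact: cw|exact: ch].
Qed.

(** On [D] the integrand vanishes off [[a, b]], so it is a continuous function cut down to the
    bounded set [[a, b]] intersected with [D], even when [D] is a half-line. *)
Lemma integrable_weight D w h (a b : R) : measurable D ->
  continuous w -> continuous h ->
  (forall t, D t -> ~ `[a, b]%classic t -> h t = 0) ->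
  mu.-integrable setT (fun t => ((w \_ D) t * h t)%:E).
Proof.
move=> mD cw ch h0.
pose f t := (w t * h t)%:E.
have If : mu.-integrable setT (f \_ (`[a, b] `&` D)).
  have mI : measurable (`[a, b]%classic `&` D) by exact: measurableI.
  apply: ((@integrable_mkcond _ _ _ mu _ f mI).1 _).
  by apply: integrableS (integrable_segment a b cw ch).
apply: eq_integrable If => // t _; rewrite /f !patchE.
have [Dt|Dt] := pselect (D t); last first.
  by rewrite memNset ?memNset ?mul0r// => -[].
have [at1|at1] := pselect (`[a, b]%classic t); first by rewrite !mem_set.
rewrite memNset; last by case.
by rewrite mem_set// h0// mulr0.
Qed.

Lemma wint_sum (I : finType) k (c : I -> R) (h : I -> R -> R) :
  (forall i, mu.-integrable setT (fun t => (k t * h i t)%:E)) ->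
  wint k (fun t => \sum_i c i * h i t) = \sum_i c i * wint k (h i).
Proof.
move=> Ih; rewrite /wint /Rintegral.
under eq_integral do rewrite mulr_sumr -sumEFin.
rewrite integral_sum//=; last first.
  move=> i; have := integrableZl measurableT (c i) (Ih i).
  by apply: eq_integrable => // t _; rewrite -EFinM mulrCA.
rewrite -[RHS]/(fine (\sum_i c i * fine (\int[mu]_t (k t * h i t)%:E))%:E) -sumEFin.
congr fine; apply: eq_bigr => i _.
under eq_integral do rewrite mulrCA EFinM.
by rewrite integralZl// -[in LHS](fineK (integrable_fin_num measurableT (Ih i))).
Qed.

Lemma FTC_segment u du (a b : R) : a < b -> continuous du ->
  (forall t : R, is_derive t 1 u (du t)) ->
  \int[mu]_(t in `[a, b]) du t = u b - u a.
Proof.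
move=> ab cdu Du.
have cu t : {for t, continuous u}.
  by apply: differentiable_continuous; apply/derivable1_diffP; exact: ex_derive.
rewrite /Rintegral (@continuous_FTC2 _ du u)//.
- exact: continuous_subspaceT.
- split=> [t _||]; first exact: ex_derive.
  + exact/cvg_at_right_filter/cu.
  + exact/cvg_at_left_filter/cu.
- by move=> t _; rewrite derive1E derive_val.
Qed.

(** The interval is open at 0 so that the kernel vanishes for every t <= 0, where the inverse
    dilation has no meaning; the missing endpoint is a null set. *)
Definition kpos w := w \_ (`]0, 1]%classic : set R).

Lemma wint_kpos w h : continuous w -> continuous h ->
  wint (kpos w) h = \int[mu]_(t in `[0, 1]) (w t * h t).
Proof.
move=> cw ch; rewrite /wint /kpos restrictM -Rintegral_mkcond.
rewrite Rintegral_itv_obnd_cbnd//.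
by apply: integrableS (integrable_segment 0 1 cw ch) => //; exact: subset_itv_oc_cc.
Qed.

Lemma cts_cst (c : R) : continuous (fun _ : R => c).
Proof. by move=> t; exact: cst_continuous. Qed.

Lemma cts_onem : continuous (fun t : R => 1 - t).
Proof. by move=> t; apply: continuousB; [exact: cst_continuous|exact: cvg_id]. Qed.

Lemma cts_subr1 : continuous (fun t : R => t - 1).
Proof. by move=> t; apply: continuousB; [exact: cvg_id|exact: cst_continuous]. Qed.

Lemma wint_taylor1 u du : continuous du -> (forall t : R, is_derive t 1 u (du t)) ->
  wint (kpos (fun=> 1)) du = u 1 - u 0.
Proof.
move=> cdu Du; rewrite (wint_kpos (@cts_cst 1))//.
by under eq_Rintegral do rewrite mul1r; exact: FTC_segment.
Qed.

Lemma wint_taylor2 u du : continuous du -> (forall t : R, is_derive t 1 u (du t)) ->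
  wint (kpos (fun=> 1)) u = u 0 + wint (kpos (fun t => 1 - t)) du.
Proof.
move=> cdu Du.
have cu : continuous u.
  by move=> t; apply: differentiable_continuous; apply/derivable1_diffP; exact: ex_derive.
rewrite (wint_kpos (@cts_cst 1) cu) (wint_kpos cts_onem cdu).
have cv : continuous (fun t : R => (1 - t) * du t - 1 * u t).
  move=> t; apply: cvgB.
    by apply: cvgM; [exact: cts_onem|exact: cdu].
  by apply: cvgM; [exact: cvg_cst|exact: cu].
(* Integration by parts through the primitive [(1 - t) * u t], which equals [u 0] at 0 and vanishes
   at 1. *)
have Dv (t : R) : is_derive t 1 (fun t : R => (1 - t) * u t) ((1 - t) * du t - 1 * u t).
  have D1 := Du t.
  have D3 : is_derive t 1 (fun t : R => 1 - t) (0 - 1) by apply: is_deriveB.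
  have := is_deriveM D3 D1.
  move=> /is_derive_eq; apply.
  by rewrite sub0r /GRing.scale /= mulrN1 mul1r.
have H := FTC_segment ltr01 cv Dv.
rewrite RintegralB// in H; last 2 first.
  exact: (integrable_segment 0 1 cts_onem cdu).
  exact: (integrable_segment 0 1 (@cts_cst 1) cu).
rewrite subrr mul0r sub0r subr0 mul1r in H.
by rewrite -[u 0]opprK -H opprB subrK.
Qed.

Lemma wint_infty u du ddu (T : R) : continuous ddu ->
  (forall t : R, is_derive t 1 u (du t)) -> (forall t : R, is_derive t 1 du (ddu t)) ->
  1 < T -> (forall t, T <= t -> u t = 0 /\ du t = 0 /\ ddu t = 0) ->
  wint ((fun t : R => t - 1) \_ `[1, +oo[%classic) ddu = u 1.
Proof.
move=> cddu Du Ddu T1 uT.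
rewrite /wint restrictM -Rintegral_mkcond.
transitivity (\int[mu]_(t in `[1, T]) ((t - 1) * ddu t)).
  rewrite Rintegral_mkcond [RHS]Rintegral_mkcond; apply: eq_Rintegral => t _; rewrite !patchE !mem_setE !in_itv/= andbT.
  case: (leP 1 t) => //= t1; case: (leP t T) => // /ltW tT.
  by have [_ [_ ->]] := uT _ tT; rewrite mulr0.
have cv : continuous (fun t : R => (t - 1) * ddu t).
  by move=> t; apply: cvgM; [exact: cts_subr1|exact: cddu].
(* Two integrations by parts in one primitive: it vanishes at [T] and equals [- u 1] at 1. *)
have Dv (t : R) : is_derive t 1 (fun t : R => (t - 1) * du t - u t) ((t - 1) * ddu t).
  have D1 := Du t; have D2 := Ddu t.
  have D3 : is_derive t 1 (fun t : R => t - 1) (1 - 0) by apply: is_deriveB.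
  have := is_deriveB (is_deriveM D3 D2) D1.
  move=> /is_derive_eq; apply.
  by rewrite subr0 /GRing.scale /= mulr1 addrK.
rewrite (FTC_segment T1 cv Dv).
by have [-> [-> _]] := uT _ (lexx T); rewrite mulr0 subr0 subrr mul0r !sub0r opprK.
Qed.

End weighted_integrals.

(** * Measurability and Fubini *)

Section measurability.
Context (R : realType).
Local Notation TR := (measurableTypeR R).

(* [f] is the pointwise limit of its values at the grid points
   [floor (n t_i) / n], and each approximation takes countably many values on
   boxes. *)
Lemma continuous_measurable_rowt m (f : 'rV[R]_m -> R) : continuous f ->
  measurable_fun setT (f \o @rowt R m).
Proof.
move=> cf.
pose fl (n : nat) (x : R) : int := Num.floor (n.+1%:R * x).
pose grid (n : nat) (z : m.-tuple int) : 'rV[R]_m := \row_i ((tnth z i)%:~R / n.+1%:R).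
pose flt n (t : m.-tuple R) : m.-tuple int := [tuple fl n (tnth t i) | i < m].
apply: (@measurable_fun_cvg _ _ _ _ (fun n => f \o grid n \o flt n)).
- move=> n _ Y mY; rewrite setTI.
  rewrite (_ : _ @^-1` _ = \bigcup_(z : m.-tuple int)
      (if f (grid n z) \in Y then [set t | flt n t = z] else set0)); last first.
    apply/seteqP; split => t /=.
      by move=> Yt; exists (flt n t) => //; rewrite mem_set.
    by move=> [z _]; case: ifPn => // /set_mem fz /= ->.
  apply: countable_bigcupT_measurable; first exact: countableP.
  move=> z; case: ifPn => // _.
  rewrite (_ : [set _ | _] = \bigcap_(i in [set: 'I_m])
      ((@tnth _ R)^~ i @^-1` [set x | fl n x = tnth z i])); last first.
    apply/seteqP; split => t /=.
      by move=> <- i _ /=; rewrite tnth_mktuple.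
    by move=> H; apply: eq_from_tnth => i; rewrite tnth_mktuple; exact: H.
  apply: fin_bigcap_measurable; first exact: finite_finset.
  move=> i _; rewrite -[X in measurable X]setTI; apply: measurable_tnth => //.
  rewrite (_ : [set _ | _] = `[(tnth z i)%:~R / n.+1%:R, (tnth z i + 1)%:~R / n.+1%:R[%classic).
    exact: measurable_itv.
  apply/seteqP; split => x /=; rewrite in_itv/= ler_pdivrMr// ltr_pdivlMr// mulrC.
    by move=> <-; rewrite floor_itv.
  by move=> h; apply/eqP; rewrite floor_eq.
- move=> t _; apply: (cvg_comp _ f); last exact: cf.
  apply/cvg_ballP => e e0; near=> n; split=> // i j.
  rewrite !mxE tnth_mktuple /ball /= /fl.
  set x := tnth t j.
  have n0 : 0 < n.+1%:R :> R by [].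
  have /andP[h1 h2] := floor_itv (n.+1%:R * x).
  rewrite ger0_norm; last by rewrite subr_ge0 ler_pdivrMr// (mulrC x).
  rewrite ltrBlDr (lt_le_trans (y := (Num.floor (n.+1%:R * x) + 1)%:~R / n.+1%:R))//.
    by rewrite ltr_pdivlMr// (mulrC x).
  rewrite intrD mulrDl addrC lerD2r mul1r ltW//.
  by near: n; exact: near_infty_natSinv_lt (PosNum e0).
Unshelve. all: by end_near. Qed.

End measurability.

Section Rintegral_extra.
Context d (T : measurableType d) (R : realType) (mu : {measure set T -> \bar R}).
Local Open Scope ereal_scope.

(** One of the two parts has infinite integral, so the extended difference is infinite (it is [-oo]
    when both are) and [fine] sends it to 0. *)
Lemma fine_integral_Nintegrable (f : T -> R) : measurable_fun setT f ->
  ~ mu.-integrable setT (EFin \o f) -> fine (\int[mu]_x (f x)%:E) = 0%R.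
Proof.
move=> mf nf.
have mEf : measurable_fun setT (EFin \o f) by exact/measurable_EFinP.
rewrite integralE.
have p0 : 0 <= \int[mu]_x (EFin \o f)^\+ x by apply: integral_ge0.
have n0 : 0 <= \int[mu]_x (EFin \o f)^\- x by apply: integral_ge0.
have : \int[mu]_x (EFin \o f)^\+ x + \int[mu]_x (EFin \o f)^\- x = +oo.
  rewrite -ge0_integralD//; last 2 first.
    exact: measurable_funepos.
    exact: measurable_funeneg.
  apply/eqP; rewrite eq_le leey/= leNgt; apply/negP => h; apply: nf.
  apply/integrableP; split => //; apply: le_lt_trans h.
  by rewrite -[X in \int[mu]_x X x <= _]/(abse \o (EFin \o f)) fune_abse.
move: p0 n0; move: (\int[mu]_x _) (\int[mu]_x _) => [a| |] [b| |] //=.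
Qed.

(** When [f] is not integrable both sides take the default value 0. Factors can thus be pulled out
    of [Kop k g y] at every [y], including those where its integral diverges. *)
Lemma RintegralZl_measurable (f : T -> R) (c : R) : measurable_fun setT f ->
  (\int[mu]_x (c * f x) = c * \int[mu]_x f x)%R.
Proof.
move=> mf.
have [If|If] := pselect (mu.-integrable setT (EFin \o f)); first exact: RintegralZl.
have [->|c0] := eqVneq c 0%R.
  rewrite mul0r /Rintegral; under eq_integral do rewrite mul0r.
  by rewrite integral0.
rewrite /Rintegral (fine_integral_Nintegrable mf If) mulr0.
apply: fine_integral_Nintegrable; first exact: measurable_funM.
apply: contra_not If => Icf.
have := integrableZl measurableT (c^-1)%R Icf.
by apply: eq_integrable => // x _ /=; rewrite -EFinM mulKf.
Qed.

Lemma Rintegral_scale_integrable (c : R) (f : T -> R) :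
  mu.-integrable setT (EFin \o f) -> mu.-integrable setT (fun x => (c * f x)%:E).
Proof. by move=> If; exact: (integrableZl measurableT c If). Qed.

End Rintegral_extra.

Section fubini_fine.
Context d1 d2 (T1 : measurableType d1) (T2 : measurableType d2) (R : realType).
Variable m1 : {sigma_finite_measure set T1 -> \bar R}.
Variable m2 : {sigma_finite_measure set T2 -> \bar R}.
Local Open Scope ereal_scope.

Lemma measurable_Rintegral1 (F : T1 * T2 -> R) : measurable_fun setT F ->
  measurable_fun setT (fun y => \int[m1]_x F (x, y))%R.
Proof.
move=> mF; apply: (measurableT_comp (fine_measurable measurableT)).
have mEF : measurable_fun setT (EFin \o F) by exact/measurable_EFinP.
rewrite (_ : (fun _ => _) = (fun y => \int[m1]_x (EFin \o F)^\+ (x, y)) \-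
   (fun y => \int[m1]_x (EFin \o F)^\- (x, y))); last first.
  apply/funext => y /=; rewrite integralE; congr (_ - _).
    by apply: eq_integral => x _; rewrite !funeposE.
  by apply: eq_integral => x _; rewrite !funenegE.
apply: emeasurable_funB.
  by apply: (measurable_fun_fubini_tonelli_G (EFin \o F)^\+) => //; exact: measurable_funepos.
by apply: (measurable_fun_fubini_tonelli_G (EFin \o F)^\-) => //; exact: measurable_funeneg.
Qed.

(** The inner integral here is a real number, with 0 in place of infinite values; it agrees with the
    inner integral of Fubini's theorem for almost every [y]. *)
Lemma fubini_Rintegral1 (F : T1 * T2 -> R) :
  (m1 \x m2).-integrable setT (EFin \o F) ->
  m2.-integrable setT (fun y => (\int[m1]_x F (x, y))%R%:E) /\
  \int[m2]_y (\int[m1]_x F (x, y))%R%:E = \int[m1]_x \int[m2]_y (F (x, y))%:E.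
Proof.
move=> IF.
have mEF := measurable_int _ IF.
have mF : measurable_fun setT F by exact/measurable_EFinP.
have mR := measurable_Rintegral1 mF.
have mG : measurable_fun setT (fun y => \int[m1]_x (F (x, y))%:E).
  exact: (measurable_fubini_G IF).
split.
  apply/integrableP; split; first exact/measurable_EFinP.
  apply: le_lt_trans ((integrable21ltyP m1 m2 mEF).1 IF).
  apply: ge0_le_integral => //.
  - by apply: measurableT_comp => //; exact/measurable_EFinP.
  - apply: (measurable_fun_fubini_tonelli_G (abse \o (EFin \o F))) => //=.
    exact: measurableT_comp.
  - move=> y _; apply: (@le_trans _ _ `|\int[m1]_x (F (x, y))%:E|).
      by rewrite /Rintegral; case: (\int[m1]_x _) => //=; rewrite ?leey// normr0.
    apply: le_abse_integral => //.
    exact: (measurableT_comp mEF (measurable_pair2 y)).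
rewrite -[RHS]/(\int[m1]_x fubini_F m2 (EFin \o F) x) (Fubini IF).
apply: ae_eq_integral => //; first exact/measurable_EFinP.
have := ae_integrable2 IF; apply: filterS => y /= Iy _.
by rewrite /Rintegral fineK//; exact: integrable_fin_num Iy.
Qed.

End fubini_fine.

(** * Averages over the isotropic dilations *)

Section jensen.
Context d (T : measurableType d) (R : realType) (mu : {measure set T -> \bar R}).
Local Open Scope ereal_scope.

(** Jensen's inequality for a weight of arbitrary mass. It is Hölder's inequality for c^(1/q) and
    c^(1/r) v with 1/q + 1/r = 1, raised to the power r, since r/q = r - 1. The case r = 1 is
    separate because q would be infinite. *)
Lemma ge0_jensen_powR (c v : T -> R) (r : R) : (1 <= r)%R ->
  measurable_fun setT c -> measurable_fun setT v ->
  (forall x, 0 <= c x)%R -> (forall x, 0 <= v x)%R ->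
  (\int[mu]_x (c x * v x)%:E) `^ r <=
  (\int[mu]_x (c x)%:E) `^ (r - 1) * \int[mu]_x (c x * v x `^ r)%:E.
Proof.
move=> r1 mc mv c0 v0.
have r0 : (0 < r)%R by exact: lt_le_trans r1.
have I0 (h : T -> R) : (forall x, 0 <= h x)%R -> 0 <= \int[mu]_x (h x)%:E.
  by move=> h0; apply: integral_ge0 => x _; rewrite lee_fin.
have [->|rn1] := eqVneq r 1%R.
  rewrite subrr poweRe0 mul1e poweRe1; last by apply: I0 => x; exact: mulr_ge0.
  by under [leRHS]eq_integral do rewrite powRr1//.
have {}r1 : (1 < r)%R by rewrite lt_neqAle eq_sym rn1.
pose q := (r / (r - 1))%R.
have q0 : (0 < q)%R by rewrite divr_gt0// subr_gt0.
have qV : (q^-1 = 1 - r^-1)%R.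
  by rewrite /q invf_div mulrBl divff ?gt_eqF// mul1r.
have qr : (q^-1 + r^-1 = 1)%R by rewrite qV subrK.
have mf : measurable_fun setT (fun x => c x `^ q^-1)%R.
  exact: (measurableT_comp (measurable_powR _)).
have mg : measurable_fun setT (fun x => c x `^ r^-1 * v x)%R.
  by apply: measurable_funM => //; exact: (measurableT_comp (measurable_powR _)).
have := hoelder mu mf mg q0 r0 qr.
rewrite Lnorm1 unlock.
under eq_integral => x _.
  rewrite /= ger0_norm; last by rewrite !mulr_ge0// powR_ge0.
  rewrite mulrA -powRD; last by rewrite qr oner_eq0.
  rewrite qr powRr1//; over.
under [X in _ <= X `^ _ * _]eq_integral => x _.
  rewrite /= ger0_norm ?powR_ge0// -powRrM mulVf ?gt_eqF// powRr1//; over.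
under [X in _ <= _ * X `^ _]eq_integral => x _.
  rewrite /= ger0_norm; last by rewrite mulr_ge0// powR_ge0.
  rewrite powRM ?powR_ge0// -powRrM mulVf ?gt_eqF// powRr1//; over.
rewrite /= => H.
have := gt0_ler_poweR (ltW r0) _ _ H.
rewrite !in_itv/= !leey !andbT poweRM ?poweR_ge0// -!poweRrM.
rewrite mulVf ?gt_eqF// poweRe1; last first.
  by apply: I0 => x; rewrite mulr_ge0// powR_ge0.
rewrite qV mulrBl mulVf ?gt_eqF// mul1r; apply.
  by apply: I0 => x; exact: mulr_ge0.
by rewrite mule_ge0// poweR_ge0.
Qed.

End jensen.

Section averaging.
Context (R : realType) (m : nat).
Local Notation TR := (measurableTypeR R).
Local Notation T := (m.-tuple R).
Local Notation leb := (@lebesgue_measure R).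
Local Notation mu := (muN R m).
Local Open Scope ereal_scope.

(* [t `^ (-1)] rather than [t^-1], because measurability of [powR] is available;
   the two agree for [0 <= t]. *)
Definition tshrink (t : R) (y : T) : T := tscale (t `^ (-1)) y.

Lemma measurable_tshrink (h : T -> R) : measurable_fun setT h ->
  measurable_fun setT (fun p : TR * T => h (tshrink p.1 p.2)).
Proof.
move=> mh; apply: (measurableT_comp mh).
apply: (measurableT_comp (@measurable_tscale_pair R m)
  (g := fun p : TR * T => ((p.1 : R) `^ (-1), p.2)%R)).
apply: measurable_fun_pair => //.
exact: (measurableT_comp (measurable_powR _) (measurable_fst (T1 := TR) (T2 := T))).
Qed.

Lemma measurable_jac (a : R -> R) : measurable_fun setT a ->
  measurable_fun setT (fun p : TR * T => (a p.1 * (p.1 : R) `^ (-1) ^+ m)%R).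
Proof.
move=> ma; apply: measurable_funM.
  exact: (measurableT_comp ma (measurable_fst (T1 := TR) (T2 := T))).
apply: measurable_funX.
exact: (measurableT_comp (measurable_powR _) (measurable_fst (T1 := TR) (T2 := T))).
Qed.

(** For each t > 0 the substitution y = t x produces t^m, which cancels the Jacobian factor t^(-m);
    times t <= 0 carry no weight. This serves both for r-th powers and to show that averaging
    preserves null functions. *)
Lemma ge0_tonelli_scale (a : R -> R) (h : T -> R) :
  measurable_fun setT a -> measurable_fun setT h ->
  (forall t, 0 <= a t)%R -> (forall t, t <= 0 -> a t = 0)%R -> (forall y, 0 <= h y)%R ->
  \int[mu]_y \int[leb]_t (a t * (t `^ (-1)) ^+ m * h (tshrink t y))%:E =
  (\int[leb]_t (a t)%:E) * \int[mu]_y (h y)%:E.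
Proof.
move=> ma mh a0 aN h0.
have Ih0 : 0 <= \int[mu]_y (h y)%:E by apply: integral_ge0 => y _; rewrite lee_fin.
have mp : measurable_fun setT (fun p : TR * T =>
    (a p.1 * ((p.1 : R) `^ (-1)) ^+ m * h (tshrink p.1 p.2))%:E).
  apply/measurable_EFinP; apply: measurable_funM; first exact: measurable_jac.
  exact: measurable_tshrink.
have p0 (p : TR * T) : 0 <= (a p.1 * ((p.1 : R) `^ (-1)) ^+ m * h (tshrink p.1 p.2))%:E.
  by rewrite lee_fin !mulr_ge0// exprn_ge0// powR_ge0.
rewrite -(fubini_tonelli (m1 := leb) (m2 := mu) _ mp p0) /fubini_F/=.
rewrite -ge0_integralZr//; last 2 first.
  exact/measurable_EFinP.
  by move=> t _; rewrite lee_fin.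
apply: eq_integral => t _.
have [t0|t0] := leP t 0%R.
  by rewrite aN// mul0e; under eq_integral do rewrite !mul0r; rewrite integral0.
have s0 : (0 < t `^ (-1))%R by exact: powR_gt0.
under eq_integral do rewrite EFinM.
rewrite ge0_integralZl//; last 3 first.
- apply/measurable_EFinP; apply: (measurableT_comp mh); exact: measurable_tscale.
- by move=> y _; rewrite lee_fin.
- by rewrite lee_fin !mulr_ge0// exprn_ge0// ltW.
rewrite (@ge0_integral_tscale R m _ (fun y => (h y)%:E))//; last exact/measurable_EFinP.
rewrite muleA -EFinM -mulrA -exprMn mulfV ?gt_eqF// expr1n mulr1//.
Qed.

Section operator.
Variable k : R -> R.
Hypothesis mk : measurable_fun setT k.
Hypothesis k0 : (forall t, 0 <= k t)%R.
Hypothesis kN : (forall t, t <= 0 -> k t = 0)%R.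

(* The formal adjoint of [psi |-> (x |-> int k(t) psi(t x) dt)]. *)
Definition Kop (g : T -> R) (y : T) : R :=
  (\int[leb]_t (k t * (t `^ (-1)) ^+ m * g (tshrink t y)))%R.

(** Extended-valued, hence [+oo] where the averaging integral diverges: the size estimates are made
    on this majorant and then passed to [Kop]. *)
Definition Kabs (g : T -> R) (y : T) : \bar R :=
  \int[leb]_t (k t * (t `^ (-1)) ^+ m * `|g (tshrink t y)|)%:E.

Lemma measurable_Kint (g : T -> R) : measurable_fun setT g ->
  measurable_fun setT (fun p : TR * T =>
    (k p.1 * ((p.1 : R) `^ (-1)) ^+ m * g (tshrink p.1 p.2))%R).
Proof.
by move=> mg; apply: measurable_funM; [exact: measurable_jac|exact: measurable_tshrink].
Qed.

Lemma measurable_Kop g : measurable_fun setT g -> measurable_fun setT (Kop g).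
Proof. by move=> mg; exact: (measurable_Rintegral1 leb (measurable_Kint mg)). Qed.

Lemma measurable_Kabs g : measurable_fun setT g -> measurable_fun setT (Kabs g).
Proof.
move=> mg; have mg' : measurable_fun setT (fun y => `|g y|)%R by exact: measurableT_comp.
apply: (measurable_fun_fubini_tonelli_G (m1 := leb) (fun p : TR * T =>
    (k p.1 * ((p.1 : R) `^ (-1)) ^+ m * `|g (tshrink p.1 p.2)|)%:E)) => /=.
  by apply/measurable_EFinP; exact: (measurable_Kint mg').
by move=> p; rewrite lee_fin !mulr_ge0// exprn_ge0// powR_ge0.
Qed.

Lemma Kabs_ge0 g y : 0 <= Kabs g y.
Proof.
by apply: integral_ge0 => t _; rewrite lee_fin !mulr_ge0// exprn_ge0// powR_ge0.
Qed.

Lemma abs_Kop_le g y : measurable_fun setT g -> `|Kop g y|%:E <= Kabs g y.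
Proof.
move=> mg.
apply: (@le_trans _ _ `|\int[leb]_t (k t * (t `^ (-1)) ^+ m * g (tshrink t y))%:E|).
  by rewrite /Kop /Rintegral; case: (\int[leb]_t _) => //=; rewrite ?leey// normr0.
rewrite /Kabs; under [leRHS]eq_integral => t _.
  rewrite -[X in (X * _)%R]ger0_norm; last by rewrite mulr_ge0// exprn_ge0// powR_ge0.
  rewrite -normrM; over.
apply: (le_abse_integral leb measurableT).
apply/measurable_EFinP.
exact: (measurableT_comp (measurable_Kint mg) (measurable_pair2 y)).
Qed.

(* The constant of Minkowski's integral inequality for [Kop] on [L^p], [q = 1/p]. *)
Definition Kcst (q : R) : \bar R :=
  \int[leb]_t (k t * (t `^ (-1)) ^+ m * t `^ (m%:R * q))%:E.

Lemma measurable_weight q : measurable_fun setT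
  (fun t : TR => k t * ((t : R) `^ (-1)) ^+ m * (t : R) `^ (m%:R * q))%R.
Proof.
apply: measurable_funM; last exact: measurable_powR.
apply: measurable_funM => //; apply: measurable_funX; exact: measurable_powR.
Qed.

Lemma Kcst_ge0 q : 0 <= Kcst q.
Proof.
by apply: integral_ge0 => t _; rewrite lee_fin !mulr_ge0// ?exprn_ge0// powR_ge0.
Qed.

(** Minkowski's bound through a pointwise Jensen inequality. The integrand is split as c v with c(t)
    = k(t) t^(-m+m/r) and v(t) = t^(-m/r) |g(y/t)|: the mass of c is [Kcst], and v^r releases
    exactly the Jacobian t^(-m). Tonelli then yields one more factor [Kcst], and the exponents r - 1
    and 1 add up to r. *)
Lemma integral_poweR_Kabs (g : T -> R) (r : R) : (1 <= r)%R -> measurable_fun setT g ->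
  \int[mu]_y (Kabs g y) `^ r <=
  Kcst r^-1 `^ r * \int[mu]_y (`|g y| `^ r)%:E.
Proof.
move=> r1 mg; have r0 : (0 < r)%R by exact: lt_le_trans r1.
pose c t := (k t * (t `^ (-1)) ^+ m * t `^ (m%:R * r^-1))%R.
have c0 t : (0 <= c t)%R by rewrite /c !mulr_ge0// ?exprn_ge0// powR_ge0.
have cN t : (t <= 0)%R -> c t = 0%R by move=> t0; rewrite /c kN// !mul0r.
have mc : measurable_fun setT c by exact: measurable_weight.
have mgr : measurable_fun setT (fun y => `|g y| `^ r)%R.
  by apply: (measurableT_comp (measurable_powR _)); exact: measurableT_comp.
have gr0 y : (0 <= `|g y| `^ r)%R by exact: powR_ge0.
have step y : (Kabs g y) `^ r <= Kcst r^-1 `^ (r - 1) *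
    \int[leb]_t (c t * (t `^ (-1)) ^+ m * `|g (tshrink t y)| `^ r)%:E.
  pose v t := (t `^ (- (m%:R * r^-1)) * `|g (tshrink t y)|)%R.
  have mv : measurable_fun setT (v : TR -> R).
    apply: measurable_funM; first exact: measurable_powR.
    apply: measurableT_comp => //.
    exact: (measurableT_comp (measurable_tshrink mg) (measurable_pair2 y)).
  have v0 t : (0 <= v t)%R by rewrite mulr_ge0// powR_ge0.
  have := @ge0_jensen_powR _ TR R leb c v r r1 mc mv c0 v0.
  rewrite (_ : \int[leb]_t (c t * v t)%:E = Kabs g y); last first.
    apply: eq_integral => t _; congr EFin; rewrite /c /v.
    have [t0|t0] := leP t 0%R; first by rewrite kN// !mul0r.
    rewrite mulrA; congr (_ * _)%R; rewrite -mulrA -powRD ?addrN ?powRr0 ?mulr1//.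
    by rewrite (gt_eqF t0) implybT.
  rewrite (_ : \int[leb]_t (c t * v t `^ r)%:E =
    \int[leb]_t (c t * (t `^ (-1)) ^+ m * `|g (tshrink t y)| `^ r)%:E)//.
  apply: eq_integral => t _; congr EFin; rewrite -mulrA; congr (_ * _)%R.
  rewrite /v powRM ?powR_ge0//; congr (_ * _)%R.
  rewrite -powRrM mulNr -mulrA mulVf ?gt_eqF// mulr1.
  by rewrite -powR_mulrn ?powR_ge0// -powRrM mulN1r.
have := ge0_tonelli_scale mc mgr c0 cN gr0.
set J := fun y => \int[leb]_t (c t * (t `^ (-1)) ^+ m * `|g (tshrink t y)| `^ r)%:E.
move=> HJ.
have J0 y : 0 <= J y.
  by apply: integral_ge0 => t _; rewrite lee_fin !mulr_ge0// ?exprn_ge0// ?powR_ge0.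
have mJ : measurable_fun setT J.
  apply: (measurable_fun_fubini_tonelli_G (m1 := leb) (fun p : TR * T =>
    (c p.1 * ((p.1 : R) `^ (-1)) ^+ m * `|g (tshrink p.1 p.2)| `^ r)%:E)) => /=.
    apply/measurable_EFinP; apply: measurable_funM; first exact: measurable_jac.
    exact: (measurable_tshrink mgr).
  by move=> p; rewrite lee_fin !mulr_ge0// ?exprn_ge0// ?powR_ge0.
apply: (@le_trans _ _ (\int[mu]_y (Kcst r^-1 `^ (r - 1) * J y))).
  apply: ge0_le_integral => //.
  - by move=> y _; exact: poweR_ge0.
  - exact: (measurableT_comp (measurable_poweR _) (measurable_Kabs mg)).
  - exact: measurable_funeM.
rewrite ge0_integralZl// ?poweR_ge0// HJ muleA.
rewrite -[X in _ * X * _ <= _]/(Kcst r^-1).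
rewrite -[X in _ * X * _ <= _]poweRe1 ?Kcst_ge0// -poweRD ?subrK//.
by apply: add_neq0_poweRD_def; rewrite subrK gt_eqF.
Qed.

End operator.
End averaging.

(** * Essential bounds and duality for the averages *)

Section averaging_duality.
Context (R : realType) (m : nat).
Local Notation TR := (measurableTypeR R).
Local Notation T := (m.-tuple R).
Local Notation leb := (@lebesgue_measure R).
Local Notation mu := (muN R m).
Local Open Scope ereal_scope.

Lemma tscaleK (s t : R) : (s * t = 1)%R -> cancel (@tscale R m t) (@tscale R m s).
Proof.
by move=> st y; apply: eq_from_tnth => i; rewrite !tnth_mktuple mulrA st mul1r.
Qed.

(** A positive factor keeps infinities in place, so both sides are [-oo] when [a] and [b] are both
    [+oo]. Scaling rules then extend to integrals that may diverge. *)
Lemma gt0_muleBr (c : R) (a b : \bar R) : (0 < c)%R -> 0 <= a -> 0 <= b ->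
  c%:E * (a - b) = c%:E * a - c%:E * b.
Proof.
move=> c0; case: a => [a| |] //; case: b => [b| |] //= _ _.
- by rewrite -EFinB -!EFinM -EFinB mulrBr.
- by rewrite gt0_muley ?lte_fin//= gt0_muleNy ?lte_fin.
- by rewrite gt0_muley ?lte_fin.
- by rewrite gt0_muley ?lte_fin//= gt0_muleNy ?lte_fin.
Qed.

Lemma integral_nneg_scale d (X : measurableType d) (nu : {measure set X -> \bar R})
    (c : R) (f : X -> \bar R) : (0 <= c)%R -> measurable_fun setT f ->
  \int[nu]_x (c%:E * f x) = c%:E * \int[nu]_x f x.
Proof.
move=> c0 mf; have [->|cn0] := eqVneq c 0%R.
  by rewrite mul0e; under eq_integral do rewrite mul0e; rewrite integral0.
have {}cn0 : (0 < c)%R by rewrite lt_neqAle eq_sym cn0.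
rewrite integralE [in RHS]integralE gt0_muleBr//; last 2 first.
- exact: integral_ge0.
- exact: integral_ge0.
rewrite ge0_funeposM// ge0_funenegM//.
rewrite !ge0_integralZl//.
- exact: measurable_funeneg.
- exact: measurable_funepos.
Qed.

Lemma integral_tscale (s : R) (f : T -> \bar R) : (0 < s)%R -> measurable_fun setT f ->
  \int[mu]_x f (tscale s x) = (s^-1 ^+ m)%:E * \int[mu]_x f x.
Proof.
move=> s0 mf; rewrite integralE [in RHS]integralE gt0_muleBr; last 3 first.
- by rewrite exprn_gt0// invr_gt0.
- exact: integral_ge0.
- exact: integral_ge0.
rewrite -ge0_integral_tscale//; last exact: measurable_funepos.
rewrite -ge0_integral_tscale//; last exact: measurable_funeneg.
congr (_ - _).
  by apply: eq_integral => x _; rewrite !funeposE.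
by apply: eq_integral => x _; rewrite !funenegE.
Qed.

Variable k : R -> R.
Hypothesis mk : measurable_fun setT k.
Hypothesis k0 : (forall t, 0 <= k t)%R.
Hypothesis kN : (forall t, t <= 0 -> k t = 0)%R.

(** Bound [|g|] by [M] plus its excess [h] over the set where [|g| > M]. The excess is null, and by
    [ge0_tonelli_scale] so is its average; the constant [M] averages to at most [C * M]. The
    exponent 0 in [Kcst] stands for 1/p at p = [+oo]. *)
Lemma Kabs_ae_le (g : T -> R) (C M : R) : measurable_fun setT g ->
  Kcst m k 0 <= C%:E -> (0 <= M)%R ->
  \int[mu]_y ((M < `|g y|)%R%:R)%:E = 0 ->
  {ae mu, forall y, Kabs k g y <= (C * M)%:E}.
Proof.
move=> mg HC M0 H0.
have mag : measurable_fun setT (fun y => `|g y|)%R by exact: measurableT_comp.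
have mI : measurable_fun setT (fun y => (M < `|g y|)%R%:R : R).
  rewrite (_ : (fun _ => _) = fun y => if (M < `|g y|)%R then 1%R else 0%R : R).
    by apply: measurable_fun_ifT => //; exact: measurable_fun_ltr.
  by apply/funext => y; case: ifP.
pose h (y : T) : R := (`|g y| * (M < `|g y|)%R%:R)%R.
have mh : measurable_fun setT h by exact: measurable_funM.
have h0 y : (0 <= h y)%R by rewrite mulr_ge0// ler0n.
have Ih : \int[mu]_y (h y)%:E = 0.
  have : ae_eq mu setT (fun y => ((M < `|g y|)%R%:R : R)%:E) (cst 0).
    have mEI : measurable_fun setT (fun y => ((M < `|g y|)%R%:R : R)%:E) by exact/measurable_EFinP.
    apply: (ae_eq_integral_abs mu measurableT mEI).1.
    by under eq_integral do rewrite gee0_abs ?lee_fin ?ler0n//.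
  move=> H.
  rewrite -[RHS](integral0 mu setT); apply: ge0_ae_eq_integral => //.
  - exact/measurable_EFinP.
  - by move=> y _; rewrite lee_fin.
  apply: filterS H => y /= /(_ I) [] H1 _.
  by rewrite /h H1 mulr0.
have := ge0_tonelli_scale mk mh k0 kN h0; rewrite Ih mule0.
pose E (y : T) := \int[leb]_t (k t * ((t : R) `^ (-1))%R ^+ m * h (tshrink t y))%:E.
rewrite -[X in X = _ -> _]/(\int[mu]_y E y) => IE.
have E0 y : 0 <= E y.
  by apply: integral_ge0 => t _; rewrite lee_fin !mulr_ge0// ?exprn_ge0// powR_ge0.
have mE : measurable_fun setT E.
  apply: (measurable_fun_fubini_tonelli_G (m1 := leb) (fun p : TR * T =>
    (k p.1 * ((p.1 : R) `^ (-1)) ^+ m * h (tshrink p.1 p.2))%:E)) => /=.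
    by apply/measurable_EFinP; exact: measurable_Kint.
  by move=> p; rewrite lee_fin !mulr_ge0// ?exprn_ge0// powR_ge0.
have : ae_eq mu setT E (cst 0).
  apply: (ae_eq_integral_abs mu measurableT mE).1.
  by under eq_integral do rewrite gee0_abs//.
apply: filterS => y /= /(_ I) Ey.
have mw : measurable_fun setT (fun t : TR => (k t * ((t : R) `^ (-1)) ^+ m * (t : R) `^ (m%:R * 0))%R).
  exact: measurable_weight.
apply: (@le_trans _ _ (\int[leb]_t ((k t * (t `^ (-1)) ^+ m * t `^ (m%:R * 0) * M)%:E +
    (k t * (t `^ (-1)) ^+ m * h (tshrink t y))%:E))).
  apply: ge0_le_integral => //.
  - by move=> t _; rewrite lee_fin !mulr_ge0// exprn_ge0// powR_ge0.
  - apply/measurable_EFinP.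
    exact: (measurableT_comp (measurable_Kint mk mag) (measurable_pair2 y)).
  - apply: emeasurable_funD; apply/measurable_EFinP; first exact: measurable_funM.
    exact: (measurableT_comp (measurable_Kint mk mh) (measurable_pair2 y)).
  - move=> t _; rewrite -EFinD lee_fin mulr0 powRr0 mulr1 -mulrDr.
    rewrite ler_wpM2l//; first by rewrite mulr_ge0// exprn_ge0// powR_ge0.
    rewrite /h; case: ltP => [_|]; last by rewrite mulr0 addr0.
    by rewrite mulr1 lerDr.
rewrite ge0_integralD//; last 4 first.
- by move=> t _; rewrite lee_fin !mulr_ge0// ?exprn_ge0// powR_ge0.
- by apply/measurable_EFinP; exact: measurable_funM.
- by move=> t _; rewrite lee_fin !mulr_ge0// ?exprn_ge0// powR_ge0.
- apply/measurable_EFinP.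
  exact: (measurableT_comp (measurable_Kint mk mh) (measurable_pair2 y)).
rewrite -[X in _ + X]/(E y) Ey adde0.
under eq_integral do rewrite EFinM.
rewrite ge0_integralZr//; last 2 first.
- exact/measurable_EFinP.
- by move=> t _; rewrite lee_fin !mulr_ge0// ?exprn_ge0// powR_ge0.
by rewrite EFinM lee_wpmul2r// lee_fin.
Qed.

(* The change of variables [y = t x] in the double integral. *)
Lemma Kop_duality (g psi : T -> R) : measurable_fun setT g -> measurable_fun setT psi ->
  \int[mu]_y (Kabs k g y * `|psi y|%:E) < +oo ->
  [/\ mu.-integrable setT (fun y => (Kop k g y * psi y)%:E),
      mu.-integrable setT (fun x => (g x * wint k (fun t => psi (tscale t x)))%:E) &
      \int[mu]_y (Kop k g y * psi y)%:E =
      \int[mu]_x (g x * wint k (fun t => psi (tscale t x)))%:E].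
Proof.
move=> mg mpsi Hfin.
pose F1 (p : TR * T) := (k p.1 * ((p.1 : R) `^ (-1)) ^+ m * g (tshrink p.1 p.2) * psi p.2)%R.
pose F2 (p : TR * T) := (k p.1 * (g p.2 * psi (tscale p.1 p.2)))%R.
have msnd : measurable_fun setT (snd : TR * T -> T) by [].
have mfst : measurable_fun setT (fst : TR * T -> TR) by [].
have mF1 : measurable_fun setT F1.
  apply: measurable_funM; first exact: measurable_Kint.
  exact: (measurableT_comp mpsi msnd).
have mpt : measurable_fun setT (fun p : TR * T => psi (tscale p.1 p.2)).
  exact: (measurableT_comp mpsi (@measurable_tscale_pair R m)).
have mF2 : measurable_fun setT F2.
  apply: measurable_funM; first exact: (measurableT_comp mk mfst).
  by apply: measurable_funM => //; exact: (measurableT_comp mg msnd).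
have G2 (t : R) : measurable_fun setT (fun x => g x * psi (tscale t x))%R.
  apply: measurable_funM => //.
  by apply: (measurableT_comp mpsi); exact: measurable_tscale.
(* For fixed t, the substitution commutes with any [phi] homogeneous under nonnegative factors: the
   norm transfers integrability from [F1] to [F2], the identity compares the integrals. *)
have F12 (t : R) (phi : R -> R) : measurable_fun setT phi ->
    (phi 0 = 0)%R -> (forall a b, 0 <= a -> phi (a * b) = a * phi b)%R ->
    \int[mu]_y (phi (F1 (t, y)))%:E = \int[mu]_x (phi (F2 (t, x)))%:E.
  move=> mphi phi0 phiM.
  have [t0|t0] := leP t 0%R.
    by rewrite /F1 /F2 /= kN//; apply: eq_integral => y _; rewrite !mul0r.
  have s0 : (0 < t `^ (-1))%R by exact: powR_gt0.
  have ts : (t * t `^ (-1) = 1)%R.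
    by rewrite powRN powRr1 ?ltW// mulfV// gt_eqF.
  pose c := (k t * (t `^ (-1)) ^+ m)%R.
  pose G x := (phi (g x * psi (tscale t x)))%R.
  have mG : measurable_fun setT G by exact: (measurableT_comp mphi (G2 t)).
  transitivity (\int[mu]_y (c%:E * (EFin \o G) (tscale (t `^ (-1)) y))).
    apply: eq_integral => y _; rewrite /F1 /G /= (tscaleK ts) -EFinM -mulrA.
    by rewrite phiM// mulr_ge0// exprn_ge0// ltW.
  rewrite integral_nneg_scale; last 2 first.
  - by rewrite mulr_ge0// exprn_ge0// ltW.
  - apply: (measurableT_comp (f := EFin \o G)); first exact/measurable_EFinP.
    exact: measurable_tscale.
  rewrite integral_tscale//; last exact/measurable_EFinP.
  rewrite muleA -EFinM /c -mulrA -exprMn mulfV ?gt_eqF// expr1n mulr1.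
  rewrite -integral_nneg_scale//; last exact/measurable_EFinP.
  by apply: eq_integral => x _; rewrite /= -EFinM -phiM.
have mEF1 : measurable_fun setT (EFin \o F1) by exact/measurable_EFinP.
have mEF2 : measurable_fun setT (EFin \o F2) by exact/measurable_EFinP.
have IF1 : (leb \x mu).-integrable setT (EFin \o F1).
  apply/(integrable21ltyP leb mu mEF1); apply: le_lt_trans Hfin.
  rewrite le_eqVlt; apply/orP; left; apply/eqP.
  apply: eq_integral => y _; rewrite /Kabs -ge0_integralZr//.
  - apply: eq_integral => t _; rewrite /F1 /= -EFinM !normrM.
    rewrite (ger0_norm (k0 t)) ger0_norm//.
    by rewrite exprn_ge0// powR_ge0.
  - apply/measurable_EFinP.
    have mag : measurable_fun setT (fun y => `|g y|)%R by exact: measurableT_comp.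
    exact: (measurableT_comp (measurable_Kint mk mag) (measurable_pair2 y)).
  - by move=> t _; rewrite lee_fin !mulr_ge0// exprn_ge0// powR_ge0.
have IF2 : (leb \x mu).-integrable setT (EFin \o F2).
  apply/(integrable12ltyP leb mu mEF2).
  have := (integrable12ltyP leb mu mEF1).1 IF1.
  rewrite (_ : \int[leb]_x \int[mu]_y _ = \int[leb]_x \int[mu]_y `|(EFin \o F2) (x, y)|)//.
  apply: eq_integral => t _; apply: (F12 t Num.norm).
  - exact: normr_measurable.
  - by rewrite normr0.
  - by move=> a b a0; rewrite normrM ger0_norm.
have [I1 E1] := fubini_Rintegral1 IF1.
have [I2 E2] := fubini_Rintegral1 IF2.
have K1 y : (\int[leb]_t F1 (t, y) = Kop k g y * psi y)%R.
  rewrite /Kop mulrC -RintegralZl_measurable.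
    by apply: eq_Rintegral => t _; rewrite /F1 mulrC.
  exact: (measurableT_comp (measurable_Kint mk mg) (measurable_pair2 y)).
have K2 x : (\int[leb]_t F2 (t, x) = g x * wint k (fun t => psi (tscale t x)))%R.
  rewrite /wint -RintegralZl_measurable.
    by apply: eq_Rintegral => t _; rewrite /F2 mulrCA.
  apply: measurable_funM => //.
  exact: (measurableT_comp mpt (measurable_pair2 x)).
have KE1 : (fun y => (\int[leb]_t F1 (t, y))%R%:E) = (fun y => (Kop k g y * psi y)%:E).
  by apply/funext => y; rewrite K1.
have KE2 : (fun y => (\int[leb]_t F2 (t, y))%R%:E) =
    (fun x => (g x * wint k (fun t => psi (tscale t x)))%:E).
  by apply/funext => y; rewrite K2.
rewrite KE1 in I1 E1; rewrite KE2 in I2 E2.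
split=> //; rewrite E1 E2; apply: eq_integral => t _.
by apply: (F12 t id).
Qed.

End averaging_duality.

(** * Power integrals near the origin and at infinity *)

Section power_integrals.
Context (R : realType).
Local Notation leb := (@lebesgue_measure R).
Local Open Scope ereal_scope.

Lemma integral_powR_segment (b u v : R) : (0 < u)%R -> (u < v)%R -> (b + 1 != 0)%R ->
  \int[leb]_(t in `[u, v]) (t `^ b)%:E = ((v `^ (b + 1) - u `^ (b + 1)) / (b + 1))%:E.
Proof.
move=> u0 uv b1.
have dpow (c t : R) : (0 < t)%R -> derivable (fun x : R => x `^ c)%R t 1.
  by move=> t0; apply: derivable_powR; rewrite in_itv/= andbT.
pose F (t : R) := ((b + 1)^-1 * t `^ (b + 1))%R.
have dF (t : R) : (0 < t)%R -> is_derive (t : R) (1%R : R) (F : R -> R) (t `^ b)%R.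
  move=> t0; have D := is_derive1_powR (b + 1) t0.
  have := @is_deriveZ _ _ _ _ (b + 1)^-1%R _ _ _ D.
  by move=> /is_derive_eq; apply; rewrite addrK /GRing.scale/= mulKf.
have cF (t : R) : (0 < t)%R -> {for t, continuous F}.
  by move=> t0; have [] := dF _ t0 => /derivable1_diffP/differentiable_continuous.
rewrite (@continuous_FTC2 R (fun t => t `^ b)%R F u v uv).
- by rewrite /F -EFinB; congr EFin; rewrite mulrBl ![(_ / (b + 1))%R]mulrC.
- apply: derivable_within_continuous => t; rewrite in_itv/= => /andP[ut _].
  exact/dpow/(lt_le_trans u0).
- split=> [t||].
  + by rewrite in_itv/= => /andP[ut _]; have [] := dF t (lt_trans u0 ut).
  + exact/cvg_at_right_filter/cF.
  + exact/cvg_at_left_filter/cF/(lt_trans u0).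
- move=> t; rewrite in_itv/= => /andP[ut _].
  by rewrite derive1E; have [_ ->] := dF t (lt_trans u0 ut).
Qed.

(** Monotone convergence along compact intervals away from 0, on which the explicit primitive of the
    power is available. *)
Lemma integral_powR_exhaustion (b B : R) (u v : nat -> R) :
  (forall n, 0 < u n)%R -> (forall n, u n < v n)%R ->
  {homo u : i j / (i <= j)%N >-> (j <= i)%R} -> {homo v : i j / (i <= j)%N >-> (i <= j)%R} ->
  (b + 1 != 0)%R ->
  (forall n, (v n `^ (b + 1) - u n `^ (b + 1)) / (b + 1) <= B)%R ->
  \int[leb]_(t in \bigcup_n `[u n, v n]%classic) (t `^ b)%:E <= B%:E.
Proof.
move=> u0 uv hu hv b1 HB.
have H := @ge0_nondecreasing_set_cvg_integral _ (measurableTypeR R) R (fun n => `[u n, v n]%classic)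
  (fun t => ((t : R) `^ b)%:E) leb.
have {}H : \int[leb]_(x in `[u i, v i]) (x `^ b)%:E @[i --> \oo] -->
    \int[leb]_(x in \bigcup_i `[u i, v i]%classic) (x `^ b)%:E.
  apply: H => //.
  - move=> i j ij; rewrite subsetEset; apply: subset_itv; rewrite bnd_simp.
      exact: hu.
    exact: hv.
  - move=> i; apply/measurable_EFinP; apply: measurable_funTS; exact: measurable_powR.
  - by move=> i t _; rewrite lee_fin powR_ge0.
have <- := cvg_lim (@ereal_hausdorff R) H.
apply: lime_le; first by apply/cvg_ex; eexists; exact: H.
by apply: nearW => n; rewrite integral_powR_segment// lee_fin.
Qed.

Lemma integral_powR_0_1 (a : R) : (a < 1)%R ->
  \int[leb]_(t in `]0%R, 1%R]) (t `^ (- a))%:E <= ((1 - a)^-1)%:E.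
Proof.
move=> a1.
have b0 : (0 < - a + 1)%R by rewrite addrC subr_gt0.
(* Starting at [n.+2] keeps every interval of the exhaustion nondegenerate, as the fundamental
   theorem requires. *)
have Hn (n : nat) : (n.+2%:R^-1 < 1 :> R)%R by rewrite invf_lt1// ltr1n.
rewrite (_ : `]0%R, 1%R]%classic = \bigcup_n `[(n.+2%:R^-1 : R)%R, 1%R]%classic).
  apply: (@integral_powR_exhaustion _ _ (fun n => n.+2%:R^-1)%R (fun=> 1%R)) => //.
  - by move=> i j ij; rewrite lef_pV2 ?posrE// ler_nat.
  - by rewrite gt_eqF.
  - move=> n; rewrite powR1 ler_pdivrMr// [X in (_ * X)%R]addrC mulVf ?gt_eqF ?subr_gt0//.
apply/seteqP; split=> t /=.
  rewrite in_itv/= => /andP[t0 t1].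
  exists (Num.truncn t^-1) => //=; rewrite in_itv/= t1 andbT.
  rewrite invf_ple ?posrE//; apply: ltW; apply: lt_le_trans (truncnS_gt _) _.
  by rewrite ler_nat.
move=> [n _]; rewrite /= !in_itv/= => /andP[h ->]; rewrite andbT.
by apply: lt_le_trans h; rewrite invr_gt0.
Qed.

Lemma integral_powR_1_infty (a : R) : (1 < a)%R ->
  \int[leb]_(t in `[1%R, +oo[) (t `^ (- a))%:E <= ((a - 1)^-1)%:E.
Proof.
move=> a1.
have b0 : (0 < a - 1)%R by rewrite subr_gt0.
have E : (- a + 1 = - (a - 1))%R by rewrite opprB addrC.
rewrite (_ : `[1%R, +oo[%classic = \bigcup_n `[1%R, (n.+2%:R : R)%R]%classic).
  apply: (@integral_powR_exhaustion _ _ (fun=> 1%R) (fun n => n.+2%:R)%R) => //.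
  - by move=> n; rewrite ltr1n.
  - by move=> i j ij; rewrite ler_nat.
  - by rewrite E oppr_eq0 gt_eqF.
  - move=> n; rewrite powR1 E invrN mulrN -mulNr opprB -[leRHS]mul1r.
    by rewrite ler_wpM2r ?invr_ge0 ?(ltW b0)// gerBl powR_ge0.
apply/seteqP; split=> t /=.
  rewrite in_itv/= andbT => t1.
  exists (Num.truncn t) => //=; rewrite in_itv/= t1/=.
  apply: ltW; apply: lt_le_trans (truncnS_gt _) _.
  by rewrite ler_nat.
by move=> [n _]; rewrite /= !in_itv/= => /andP[-> _].
Qed.

(** Only the growth exponent [e] of the kernel enters: it will be 0 for the two inner kernels and 1
    for the outer one. *)
Lemma Kcst_restrict_le (m : nat) (w : R -> R) (D : set R) (q e : R) :
  measurable D -> measurable_fun setT w ->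
  (forall t, D t -> 0 < t /\ 0 <= w t <= t `^ e)%R ->
  Kcst m (w \_ D) q <= \int[leb]_(t in D) (t `^ (e - m%:R + m%:R * q))%:E.
Proof.
move=> mD mw Hw; rewrite [leRHS]integral_mkcond; apply: ge0_le_integral => //.
- move=> t _; rewrite lee_fin !mulr_ge0 ?exprn_ge0 ?powR_ge0//.
  rewrite patchE; case: ifPn => // /set_mem Dt.
  by have [_ /andP[]] := Hw _ Dt.
- apply/measurable_EFinP; apply: measurable_weight.
  apply/(measurable_restrictT _ mD); exact: measurable_funTS.
- apply/(measurable_restrictT _ mD); apply/measurable_EFinP; apply: measurable_funTS.
  exact: measurable_powR.
- move=> t _; rewrite !patchE; case: ifPn => [/set_mem Dt|_]; last by rewrite !mul0r.
  have [t0 /andP[w0 we]] := Hw _ Dt.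
  rewrite lee_fin -powR_mulrn ?powR_ge0// -powRrM mulN1r.
  rewrite powRD ?(gt_eqF t0) ?implybT// powRD ?(gt_eqF t0) ?implybT//.
  by rewrite !ler_wpM2r// powR_ge0.
Qed.

End power_integrals.

(** * Left-invariant fields along rays *)

Section smooth_class.
Context (R : realType) (G : carnot R).
Implicit Types (f g : pt G -> R) (k : nat).

Lemma smoothkS k f : smoothk k.+1 f -> smoothk k f.
Proof.
elim: k f => [|k IH] f [df sf].
  by move=> x; apply: differentiable_continuous.
by split=> // i; exact/IH/sf.
Qed.

Lemma smoothk_continuous k f : smoothk k f -> continuous f.
Proof. by elim: k => // k IH /smoothkS. Qed.

Lemma smoothk_cst k (c : R) : smoothk (G := G) k (fun=> c).
Proof.
elim: k c => [|k IH] c /=; first by move=> x; exact: cst_continuous.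
split=> [x|i]; first exact: differentiable_cst.
have -> : (fun x : pt G => derive (fun=> c : R) x (ebasis i)) = (fun=> 0 : R).
  by apply/funext => x; exact: derive_cst.
exact: IH.
Qed.

Lemma smoothkD k f g : smoothk k f -> smoothk k g ->
  smoothk k (fun x => f x + g x).
Proof.
elim: k f g => [|k IH] f g /=; first by move=> cf cg x; apply: continuousD; [exact: cf|exact: cg].
move=> [df sf] [dg sg]; split=> [x|i]; first exact: differentiableD.
rewrite (_ : (fun x => _) = fun x => derive f x (ebasis i) + derive g x (ebasis i)).
  by apply: IH; [exact: sf|exact: sg].
by apply/funext => x; apply: deriveD; exact: diff_derivable.
Qed.

Lemma smoothkM k f g : smoothk k f -> smoothk k g ->
  smoothk k (fun x => f x * g x).
Proof.
elim: k f g => [|k IH] f g.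
  by move=> cf cg x; apply: continuousM; [exact: cf|exact: cg].
move=> sf sg; have sf' := smoothkS sf; have sg' := smoothkS sg.
case: sf sg => df sf [dg sg]; split=> [x|i]; first exact: differentiableM.
rewrite (_ : (fun x => _) = fun x => f x * derive g x (ebasis i) + g x * derive f x (ebasis i)).
  by apply: smoothkD; apply: IH => //; [exact: sg|exact: sf].
by apply/funext => x; apply: deriveM; exact: diff_derivable.
Qed.

Lemma smoothk_sum k (I : Type) (r : seq I) (P : pred I) (F : I -> pt G -> R) :
  (forall i, P i -> smoothk k (F i)) -> smoothk k (fun x => \sum_(i <- r | P i) F i x).
Proof.
move=> sF; elim: r => [|i r IH].
  by under eq_fun do rewrite big_nil; exact: smoothk_cst.
have [Pi|Pi] := boolP (P i); last by under eq_fun do rewrite big_cons (negbTE Pi).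
by under eq_fun do rewrite big_cons Pi; apply: smoothkD => //; exact: sF.
Qed.

Lemma smoothk_coord k (i : 'I_(cN G)) : smoothk (G := G) k (fun x => x ord0 i).
Proof.
have cc : continuous (fun x : pt G => x ord0 i) by exact: coord_continuous.
case: k => [//|k] /=; split=> [x|j]; first exact: differentiable_coord.
rewrite (_ : (fun x => _) = fun=> ebasis j ord0 i); first exact: smoothk_cst.
apply/funext => x.
have lf : linear (fun x : pt G => x ord0 i : R) by move=> a u v; rewrite !mxE.
pose L := GRing.isLinear.Build R (pt G) R _ _ lf.
pose f : {linear pt G -> R} := HB.pack (fun x : pt G => x ord0 i : R) L.
rewrite deriveE; last exact: differentiable_coord.
by rewrite (diff_lin x (f := f)).
Qed.

Lemma lbr_coord (x y : pt G) l :
  lbr x y ord0 l = \sum_i \sum_j x ord0 i * y ord0 j * cc i j l.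
Proof. by rewrite mxE. Qed.

(** The components are polynomials in [x]: finite combinations of iterated brackets with [x], each
    bracket being bilinear in coordinates. *)
Lemma smoothk_lvf k i j : smoothk (G := G) k (fun x => lvf i x ord0 j).
Proof.
have H n l : smoothk (G := G) k (fun x => iter n (lbr x) (ebasis i) ord0 l).
  elim: n l => [|n IH] l /=; first exact: smoothk_cst.
  under eq_fun do rewrite lbr_coord.
  apply: smoothk_sum => a _; apply: smoothk_sum => b _.
  apply: smoothkM; last exact: smoothk_cst.
  by apply: smoothkM => //; exact: smoothk_coord.
under eq_fun do rewrite /lvf summxE.
apply: smoothk_sum => n _; under eq_fun do rewrite mxE.
by apply: smoothkM => //; exact: smoothk_cst.
Qed.

Lemma derive_sum_coord f x (v : pt G) : differentiable f x ->
  derive f x v = \sum_j v ord0 j * derive f x (ebasis j).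
Proof.
move=> df; rewrite deriveE// {1}(row_sum_delta v) linear_sum.
by apply: eq_bigr => j _; rewrite linearZ /= deriveE.
Qed.

Lemma smoothk_Xop k i f : smoothk k.+1 f -> smoothk k (Xop i f).
Proof.
move=> [df sf]; rewrite (_ : Xop i f = fun x => \sum_j lvf i x ord0 j * derive f x (ebasis j)).
  by apply: smoothk_sum => j _; apply: smoothkM; [exact: smoothk_lvf|exact: sf].
by apply/funext => x; exact: derive_sum_coord.
Qed.

Lemma Xop_eq0 i f (K : set (pt G)) : closed K ->
  (forall x, ~ K x -> f x = 0) -> forall x, ~ K x -> Xop i f x = 0.
Proof.
move=> cK f0 x Kx; rewrite /Xop.
rewrite (@near_eq_derive _ _ _ f (cst 0)); first exact: derive_cst.
have : open (~` K) by exact: closed_openC.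
rewrite openE => /(_ x Kx); rewrite /interior; apply: filterS => y; exact: f0.
Qed.

Lemma continuous_bounded f (K : set (pt G)) : compact K -> continuous f ->
  (forall x, ~ K x -> f x = 0) -> exists2 M, 0 < M & forall x, `|f x| <= M.
Proof.
move=> cK cf f0.
have : compact (f @` K).
  by apply: continuous_compact => //; exact: continuous_subspaceT.
move=> /compact_bounded/ex_strict_bound_gt0[M M0 HM].
exists M => // x; have [Kx|Kx] := pselect (K x); first by apply/ltW/HM; exists x.
by rewrite f0// normr0 ltW.
Qed.

Lemma compact_coord_bounded (K : set (pt G)) : compact K ->
  exists2 M, 0 < M & forall x, K x -> forall i, `|x ord0 i| <= M.
Proof.
move=> /compact_bounded/ex_strict_bound_gt0[M M0 HM].
exists M => // x Kx i; apply: le_trans (ltW (HM _ Kx)).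
rewrite /Num.norm/= mx_normrE.
exact: (@le_bigmax _ _ _ 0 (fun ij : 'I_1 * 'I_(cN G) => `|x ij.1 ij.2|) (ord0, i)).
Qed.

End smooth_class.

(** * The Euler field in the left-invariant frame *)

Section euler.
Context (R : realType) (G : carnot R).

Lemma lbr_sumr (y : pt G) (a : 'I_(cN G) -> R) (v : 'I_(cN G) -> pt G) :
  lbr y (\sum_i a i *: v i) = \sum_i a i *: lbr y (v i).
Proof.
apply/rowP => l; rewrite lbr_coord summxE.
under [RHS]eq_bigr do rewrite mxE lbr_coord.
under [RHS]eq_bigr do rewrite mulr_sumr.
rewrite [RHS]exchange_big/=; apply: eq_bigr => p _.
under [RHS]eq_bigr do rewrite mulr_sumr.
rewrite [RHS]exchange_big/=; apply: eq_bigr => q _.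
rewrite summxE mulr_sumr mulr_suml; apply: eq_bigr => i _.
by rewrite mxE mulrA (mulrC (y _ _)) -!mulrA.
Qed.

(** By antisymmetry of the structure constants, exchanging the two summation indices shows that each
    coordinate is its own opposite. *)
Lemma lbr_scalexx (t : R) (x : pt G) : lbr (t *: x) x = 0.
Proof.
apply/rowP => l; rewrite lbr_coord mxE; apply/eqP; rewrite -eqNr; apply/eqP.
rewrite [RHS]exchange_big/= -sumrN; apply: eq_bigr => i _.
rewrite -sumrN; apply: eq_bigr => j _.
rewrite !mxE cc_antisym mulrN opprK -!mulrA; congr (_ * _).
by rewrite !mulrA (mulrC (x ord0 i)).
Qed.

Lemma lbrx0 (x : pt G) : lbr x 0 = 0.
Proof.
by apply/rowP => l; rewrite lbr_coord mxE big1// => i _; rewrite big1// => j _; rewrite mxE mulr0 mul0r.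
Qed.

Lemma bcoef0 : bcoef R 0 = 1.
Proof. by rewrite /bcoef /= /bern /= fact0 divr1. Qed.

(* In exponential coordinates [t |-> t x] is the integral curve of the
   left-invariant field [sum_i x_i X^i]. *)
Lemma sum_lvf (t : R) (x : pt G) : \sum_i x ord0 i *: lvf i (t *: x) = x.
Proof.
have H k : \sum_i x ord0 i *: iter k (lbr (t *: x)) (ebasis i) =
           iter k (lbr (t *: x)) x.
  elim: k => [|k IH] /=; first by rewrite -row_sum_delta.
  by rewrite -IH lbr_sumr.
under eq_bigr do rewrite /lvf scaler_sumr.
rewrite exchange_big /=.
transitivity (\sum_(k < cs G) bcoef R k *: iter k (lbr (t *: x)) x).
  apply: eq_bigr => k _; rewrite -H scaler_sumr; apply: eq_bigr => i _.
  by rewrite !scalerA mulrC.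
(* A positive step guarantees that the series contains its zeroth term, with coefficient 1; it is
   the only one that survives. *)
have := cs_gt0 G; case: (cs G) => // s _.
rewrite big_ord_recl /= bcoef0 scale1r big1 ?addr0// => k _ /=.
have I0 n : iter n.+1 (lbr (t *: x)) x = 0.
  by elim: n => [|n IH]; [exact: lbr_scalexx|rewrite iterS IH lbrx0].
by rewrite add0n -iterS I0 scaler0.
Qed.

Lemma is_derive_ray (f : pt G -> R) (x : pt G) (t : R) : differentiable f (t *: x) ->
  is_derive t 1 (fun s => f (s *: x)) (\sum_i x ord0 i * Xop i f (t *: x)).
Proof.
move=> df.
have dg : is_diff t (fun s : R => s *: x) (fun s => s *: x).
  exact: is_diff_scalel.
have E : \sum_i x ord0 i * Xop i f (t *: x) = 'd f (t *: x) x.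
  transitivity ('d f (t *: x) (\sum_i x ord0 i *: lvf i (t *: x))).
    by rewrite linear_sum; apply: eq_bigr => i _; rewrite linearZ /= /Xop deriveE.
  by rewrite sum_lvf.
rewrite E.
have dfg : is_diff t (fun s => f (s *: x)) ('d f (t *: x) \o (fun s => s *: x)).
  have df' := differentiableP df.
  exact: (@is_diff_comp _ _ _ _ _ _ f _ t dg df').
split; first by apply: diff_derivable; exact: ex_diff.
by rewrite deriveE// diff_val /= scale1r.
Qed.

End euler.

(** * Back to functions on the group *)

Section box.
Context (R : realType).
Local Notation leb := (@lebesgue_measure R).
Local Open Scope ereal_scope.

(** The indicator of a cube, written as a product over the coordinates so that its integral
    factorises along the recursion of [muN]. With [b = 0] it is the indicator of the origin. *)
Definition boxf (b : R) m (t : m.-tuple R) : R := (\prod_i (`|tnth t i| <= b)%R%:R)%R.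

Lemma boxf_ge0 b m (t : m.-tuple R) : (0 <= boxf b t)%R.
Proof. by apply: prodr_ge0 => i _; rewrite ler0n. Qed.

Lemma boxf_in b m (t : m.-tuple R) : (forall i, `|tnth t i| <= b)%R -> boxf b t = 1%R.
Proof. by move=> H; rewrite /boxf big1// => i _; rewrite H. Qed.

Lemma boxf_out b m (t : m.-tuple R) i : ~~ (`|tnth t i| <= b)%R -> boxf b t = 0%R.
Proof. by move=> /negbTE H; rewrite /boxf (bigD1 i)//= H mul0r. Qed.

Lemma boxf_le1 b m (t : m.-tuple R) : (boxf b t <= 1)%R.
Proof.
have [/forallP H|] := boolP [forall i, `|tnth t i| <= b]%R; first by rewrite boxf_in.
by rewrite negb_forall => /existsP[i Hi]; rewrite (boxf_out Hi).
Qed.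

Lemma measurable_le_norm (b : R) : measurable_fun setT (fun x : R => (`|x| <= b)%R%:R : R).
Proof.
rewrite (_ : (fun _ => _) = fun x => if (`|x| <= b)%R then 1%R else 0%R : R).
  apply: measurable_fun_ifT => //.
  exact: (measurable_fun_ler (@normr_measurable R setT) (measurable_cst b)).
by apply/funext => x; case: ifP.
Qed.

Lemma measurable_boxf b m : measurable_fun setT (@boxf b m).
Proof.
apply: measurable_prod => i _ .
exact: (measurableT_comp (measurable_le_norm b) (measurable_tnth i)).
Qed.

Lemma integral_boxf_lty b m : \int[muN R m]_t (boxf b t)%:E < +oo.
Proof.
elim: m => [|m IH].
  rewrite integral_dirac//=; last by apply/measurable_EFinP; exact: measurable_boxf.
  by rewrite diracE mem_set// mul1e ltry.
rewrite ge0_integral_cons_measure; last 2 first.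
- by apply/measurable_EFinP; exact: measurable_boxf.
- by move=> t; rewrite lee_fin boxf_ge0.
have I0 : 0 <= \int[muN R m]_t (boxf b t)%:E.
  by apply: integral_ge0 => t _; rewrite lee_fin boxf_ge0.
rewrite (_ : \int[leb]_a _ = \int[leb]_a (((`|a| <= b)%R%:R : R)%:E * \int[muN R m]_t (boxf b t)%:E)); last first.
  apply: eq_integral => a _; rewrite -ge0_integralZl//.
  - apply: eq_integral => t _; rewrite -EFinM /boxf big_ord_recl.
    by congr (_ * _)%:E; apply: eq_bigr => i _; rewrite tnthS.
  - by apply/measurable_EFinP; exact: measurable_boxf.
  - by move=> t _; rewrite lee_fin boxf_ge0.
rewrite ge0_integralZr//; last by apply/measurable_EFinP; exact: measurable_le_norm.
apply: lte_mul_pinfty => //.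
- by apply: integral_ge0 => t _; rewrite lee_fin ler0n.
- rewrite ge0_fin_numE; last by apply: integral_ge0 => t _; rewrite lee_fin ler0n.
  rewrite (_ : (fun _ => _) = fun x => (\1_(`[(- b)%R, b]%classic : set R) x)%:E).
    rewrite (@integral_indic _ (measurableTypeR R) R leb setT measurableT)// setIT.
    rewrite [X in X < _](lebesgue_measure_itv `[(- b)%R, b])/=.
    by case: ifP => _; rewrite ?ltry// -EFinB ltry.
  by apply/funext => x; rewrite indicE mem_setE in_itv/= ler_norml.
Qed.

(** The whole space is not null; this is what excludes negative essential upper bounds. *)
Lemma muN_integral1_neq0 m : \int[muN R m]_t (1%R : R)%:E != 0.
Proof.
elim: m => [|m IH].
  by rewrite integral_dirac//= diracE mem_set// mul1e eqe oner_eq0.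
rewrite ge0_integral_cons_measure//.
rewrite integral_cst//=.
have c0 : 0 < \int[muN R m]_t (1%R : R)%:E.
  by rewrite lt_neqAle eq_sym IH; apply: integral_ge0.
by rewrite -set_itvNyy lebesgue_measure_itv/= gt0_muley.
Qed.

(* The point [0] is invariant under dilations, which multiply [muN] by [2 ^ m]. *)
Lemma integral_boxf0 m : (0 < m)%N -> \int[muN R m]_t (boxf 0 t)%:E = 0.
Proof.
move=> m0; have mb : measurable_fun setT (fun t : m.-tuple R => (boxf 0 t)%:E).
  by apply/measurable_EFinP; exact: measurable_boxf.
have b0 (t : m.-tuple R) : 0 <= (boxf 0 t)%:E by rewrite lee_fin boxf_ge0.
have s0 : (0 < 2^-1 :> R)%R by rewrite invr_gt0.
have := ge0_integral_tscale s0 mb b0.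
rewrite (eq_integral (fun t => (boxf 0 t)%:E)); last first.
  move=> t _; congr EFin; apply: eq_bigr => i _.
  by rewrite tnth_mktuple !normr_le0 mulf_eq0 gt_eqF.
have := integral_boxf_lty 0 m.
have : 0 <= \int[muN R m]_t (boxf 0 t)%:E by exact: integral_ge0.
case: (\int[muN R m]_t (boxf 0 t)%:E) => // r _ _ [] /eqP.
rewrite invrK -subr_eq0 -{1}(mul1r r) -mulrBl mulf_eq0 subr_eq0 => /orP[|/eqP->//].
have : (1 < 2 ^+ m :> R)%R by rewrite exprn_egt1// ?ltr1n// -lt0n.
by move=> /lt_eqF ->.
Qed.

End box.

(** * Integrals and [L^p] norms on the group as integrals over tuples *)

Section link.
Context (R : realType) (G : carnot R).
Local Notation N := (cN G).
Local Notation mu := (muN R N).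
Local Notation rt := (@rowt R N).
Implicit Types (f g h : pt G -> R).

Definition tupof (x : pt G) : N.-tuple R := [tuple x ord0 i | i < N].

Lemma rowtK : cancel rt tupof.
Proof. by move=> t; apply: eq_from_tnth => i; rewrite tnth_mktuple mxE. Qed.

Lemma rmeas_tupof (h : N.-tuple R -> R) : measurable_fun setT h -> rmeas (h \o tupof).
Proof.
move=> mh; rewrite /rmeas (_ : (fun _ => _) = h)//.
by apply/funext => t; rewrite /= -/(rt t) rowtK.
Qed.

Lemma continuous_rmeas f : continuous f -> rmeas f.
Proof. exact: continuous_measurable_rowt. Qed.

Lemma rmeasM f g : rmeas f -> rmeas g -> rmeas (fun x => f x * g x).
Proof. by move=> mf mg; exact: (measurable_funM mf mg). Qed.

Lemma rmeas_cst (c : R) : rmeas (G := G) (fun=> c).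
Proof. exact: measurable_cst. Qed.

Lemma rmeas_coord i : rmeas (G := G) (fun x => x ord0 i).
Proof. by apply: continuous_rmeas; exact: coord_continuous. Qed.

Lemma nnintE f : rmeas f -> (forall x, 0 <= f x) ->
  nnint (fun x => (f x)%:E) = (\int[mu]_t (f (rt t))%:E)%E.
Proof.
move=> mf f0; apply: iintE => [|x]; last by rewrite lee_fin.
by apply/measurable_EFinP.
Qed.

(** Integrability is bundled with the value because [intN], a difference of [fine] values, can be
    handled linearly only once it is known. *)
Definition has_int f (v : R) :=
  mu.-integrable setT (fun t => (f (rt t))%:E) /\ \int[mu]_t f (rt t) = v.

Lemma has_int_intN f v : has_int f v -> intN f = v.
Proof.
move=> [If <-].
have mf : rmeas f by apply/measurable_EFinP; exact: measurable_int If.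
rewrite /intN nnintE; last 2 first.
- exact: measurable_maxr.
- by move=> x; rewrite le_max lexx orbT.
rewrite nnintE; last 2 first.
- by apply: measurable_maxr => //; exact: measurableT_comp.
- by move=> x; rewrite le_max lexx orbT.
pose F t := (f (rt t))%:E.
transitivity (fine (\int[mu]_t F^\+ t - \int[mu]_t F^\- t)%E); last first.
  by congr fine; rewrite [RHS](integralE mu setT F).
have := fineB (integrable_pos_fin_num measurableT If)
  (integrable_neg_fin_num measurableT If).
move=> /= ->.
congr (fine _ - fine _).
  by apply: eq_integral => t _; rewrite funeposE -EFin_max.
by apply: eq_integral => t _; rewrite funenegE -EFinN -EFin_max.
Qed.

Lemma integrable_has_int f : mu.-integrable setT (fun t => (f (rt t))%:E) ->
  has_int f (intN f).
Proof. by move=> If; split=> //; rewrite (@has_int_intN f (\int[mu]_t f (rt t))). Qed.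

Lemma has_int_eq f g v : (forall x, f x = g x) -> has_int f v -> has_int g v.
Proof. by move=> /funext ->. Qed.

Lemma has_int0 : has_int (fun=> 0) 0.
Proof. by split; [exact: integrable0|rewrite /Rintegral integral0]. Qed.

Lemma has_intD f g u v : has_int f u -> has_int g v ->
  has_int (fun x => f x + g x) (u + v).
Proof.
move=> [If <-] [Ig <-]; split; last by rewrite RintegralD.
by under eq_fun do rewrite EFinD; exact: integrableD.
Qed.

Lemma has_intZ (c : R) f v : has_int f v -> has_int (fun x => c * f x) (c * v).
Proof.
by move=> [If <-]; split; [exact: Rintegral_scale_integrable|rewrite RintegralZl].
Qed.

Lemma has_int_sum (I : Type) (s : seq I) (P : pred I) (f : I -> pt G -> R) (v : I -> R) :
  (forall i, P i -> has_int (f i) (v i)) ->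
  has_int (fun x => \sum_(i <- s | P i) f i x) (\sum_(i <- s | P i) v i).
Proof.
move=> H; elim: s => [|i s IH].
  by rewrite big_nil; apply: has_int_eq has_int0 => x; rewrite big_nil.
have [Pi|Pi] := boolP (P i).
  rewrite big_cons Pi; apply: has_int_eq (has_intD (H i Pi) IH) => x.
  by rewrite big_cons Pi.
by rewrite big_cons (negbTE Pi); apply: has_int_eq IH => x; rewrite big_cons (negbTE Pi).
Qed.

Lemma has_int_bound f g : rmeas f -> rmeas g -> (forall x, `|f x| <= g x) ->
  (nnint (fun x => (g x)%:E) < +oo)%E -> has_int f (intN f).
Proof.
move=> mf mg fg Hg; apply: integrable_has_int; apply/integrableP; split.
  exact/measurable_EFinP.
have g0 x : 0 <= g x by apply: le_trans (fg x).
rewrite nnintE// in Hg; apply: le_lt_trans Hg; apply: ge0_le_integral => //.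
- by apply: measurableT_comp => //; exact/measurable_EFinP.
- exact/measurable_EFinP.
- by move=> t _; rewrite lee_fin.
Qed.

Local Open Scope ereal_scope.

Lemma rmeas_norm f : rmeas f -> rmeas (fun x => `|f x|%R).
Proof. by move=> mf; exact: measurableT_comp. Qed.

Lemma rmeas_powR f r : rmeas f -> rmeas (fun x => (`|f x| `^ r)%R).
Proof.
move=> mf; exact: (measurableT_comp (measurable_powR r) (rmeas_norm mf)).
Qed.

Lemma rmeas_gt f (M : \bar R) : rmeas f -> rmeas (fun x => (M < `|f x|%:E)%E%:R : R).
Proof.
move=> mf; case: M => [r| |].
- rewrite (_ : (fun _ => _) = fun x => if (r < `|f x|)%R then 1%R else 0%R : R).
    apply: measurable_fun_ifT => //.
    exact: (measurable_fun_ltr (measurable_cst r) (rmeas_norm mf)).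
  by apply/funext => x; rewrite lte_fin; case: ifP.
- rewrite (_ : (fun _ => _) = fun=> 0%R); first exact: rmeas_cst.
  by apply/funext => x; rewrite ltNge leey.
- rewrite (_ : (fun _ => _) = fun=> 1%R); first exact: rmeas_cst.
  by apply/funext => x; rewrite ltNyr.
Qed.

Lemma LpN_finE f (r : R) : rmeas f ->
  LpN r%:E f = (\int[mu]_t (`|f (rt t)| `^ r)%:E) `^ r^-1.
Proof.
by move=> mf; rewrite /LpN nnintE//; exact: rmeas_powR.
Qed.

Lemma gt_set_nnint f (M : \bar R) : rmeas f ->
  nnint (fun x => ((M < `|f x|%:E)%E%:R : R)%:E) =
  \int[mu]_t ((M < `|f (rt t)|%:E)%E%:R : R)%:E.
Proof. by move=> mf; apply: nnintE; [exact: rmeas_gt|move=> x; rewrite ler0n]. Qed.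

Lemma gt_nnint_mono f g (M M' : \bar R) : rmeas f -> rmeas g ->
  (forall x, M' < `|g x|%:E -> M < `|f x|%:E) ->
  nnint (fun x => ((M < `|f x|%:E)%E%:R : R)%:E) = 0 ->
  nnint (fun x => ((M' < `|g x|%:E)%E%:R : R)%:E) = 0.
Proof.
move=> mf mg H; rewrite !gt_set_nnint// => H0.
apply/eqP; rewrite eq_le -{1}H0; apply/andP; split; last first.
  by apply: integral_ge0 => t _; rewrite lee_fin ler0n.
apply: ge0_le_integral => //.
- by apply/measurable_EFinP; exact: (rmeas_gt M' mg).
- by apply/measurable_EFinP; exact: (rmeas_gt M mf).
- move=> t _; rewrite lee_fin ler_nat; have := H (rt t).
  by case: (M' < _) => // ->.
Qed.

Lemma LpN_mono (p : \bar R) f g : 1 <= p -> rmeas f -> rmeas g ->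
  (forall x, `|f x| <= `|g x|)%R -> LpN p f <= LpN p g.
Proof.
case: p => [r| |] // r1 mf mg fg.
  have r0 : (0 < r)%R by move: r1; rewrite lee_fin; exact: lt_le_trans.
  rewrite !LpN_finE//.
  apply: gt0_ler_poweR; rewrite ?invr_ge0 ?(ltW r0)//.
  - by rewrite in_itv/= leey andbT integral_ge0// => t _; rewrite lee_fin powR_ge0.
  - by rewrite in_itv/= leey andbT integral_ge0// => t _; rewrite lee_fin powR_ge0.
  apply: ge0_le_integral => //.
  - by apply/measurable_EFinP; exact: rmeas_powR.
  - by apply/measurable_EFinP; exact: rmeas_powR.
  - by move=> t _; rewrite lee_fin ge0_ler_powR// ?nnegrE// ltW.
rewrite /LpN /esssupN; apply: ereal_inf_le_tmp => M /= H.
apply: (gt_nnint_mono mg mf _ H) => x; move/lt_le_trans; apply.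
by rewrite lee_fin.
Qed.

Lemma inLp_mono (p : \bar R) f g : 1 <= p -> rmeas f -> inLp p g ->
  (forall x, `|f x| <= `|g x|)%R -> inLp p f.
Proof.
move=> p1 mf [mg g1] fg; split=> //; exact: le_lt_trans (LpN_mono p1 mf mg fg) g1.
Qed.

(** The infimum in [esssupN] runs over all extended reals. For negative [M] the superlevel set is
    everything, which is not null. *)
Lemma esssupN_ge0 f (M : \bar R) : rmeas f ->
  nnint (fun x => ((M < `|f x|%:E)%E%:R : R)%:E) = 0 -> 0 <= M.
Proof.
move=> mf; rewrite gt_set_nnint// => H; rewrite leNgt; apply/negP => M0.
have := muN_integral1_neq0 R N; rewrite -H => /eqP; apply.
by apply: eq_integral => t _; rewrite (lt_le_trans M0)// lee_fin.
Qed.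

End link.

(** * The averaging operators on [L^p] of the group *)

Section averaging_Lp.
Context (R : realType) (G : carnot R).
Local Notation N := (cN G).
Local Notation mu := (muN R N).
Local Notation rt := (@rowt R N).
Implicit Types (f g h psi : pt G -> R).

Variable k : R -> R.
Hypothesis mk : measurable_fun setT k.
Hypothesis k0 : forall t, 0 <= k t.
Hypothesis kN : forall t, t <= 0 -> k t = 0.

Definition avg g : pt G -> R := Kop k (g \o rt) \o tupof (G := G).

(* [1 / p], with value [0] at [+oo]. *)
Definition invexp (p : \bar R) : R := if p is r%:E then r^-1 else 0.

Local Open Scope ereal_scope.
Variables (p : \bar R) (C : R).
Hypothesis p1 : 1 <= p.
Hypothesis C0 : (0 <= C)%R.
Hypothesis HC : Kcst N k (invexp p) <= C%:E.

Lemma avg_rowt g t : avg g (rt t) = Kop k (g \o rt) t.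
Proof. by rewrite /avg /= rowtK. Qed.

Lemma rmeas_avg g : rmeas g -> rmeas (avg g).
Proof. by move=> mg; apply: rmeas_tupof; exact: measurable_Kop. Qed.

Lemma LpN_avg g : inLp p g -> LpN p (avg g) <= C%:E * LpN p g.
Proof.
move=> [mg gp]; have mF := rmeas_avg mg.
move: p1 HC gp; case: p => [r| |] // r1 HCr gp.
  have {}r1 : (1 <= r)%R by move: r1; rewrite lee_fin.
  have r0 : (0 < r)%R by move: r1; exact: lt_le_trans.
  have K0 : 0 <= Kcst N k r^-1 by exact: Kcst_ge0.
  have I0 : 0 <= \int[mu]_y (`|g (rt y)| `^ r)%:E.
    by apply: integral_ge0 => t _; rewrite lee_fin powR_ge0.
  have H : \int[mu]_t (`|avg g (rt t)| `^ r)%:E <=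
      Kcst N k r^-1 `^ r * \int[mu]_y (`|g (rt y)| `^ r)%:E.
    apply: le_trans (integral_poweR_Kabs mk k0 kN r1 mg).
    apply: ge0_le_integral => //.
    - by apply/measurable_EFinP; exact: rmeas_powR.
    - exact: (measurableT_comp (measurable_poweR _) (measurable_Kabs mk k0 mg)).
    - move=> t _; rewrite -poweR_EFin; apply: gt0_ler_poweR; rewrite ?(ltW r0)//.
      + by rewrite in_itv/= leey andbT lee_fin.
      + by rewrite in_itv/= leey andbT Kabs_ge0.
      + by rewrite avg_rowt; exact: abs_Kop_le.
  rewrite !LpN_finE//.
  apply: (@le_trans _ _ ((Kcst N k r^-1 `^ r * \int[mu]_y (`|g (rt y)| `^ r)%:E) `^ r^-1)).
    apply: gt0_ler_poweR; rewrite ?invr_ge0 ?(ltW r0)//.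
    - by rewrite in_itv/= leey andbT integral_ge0// => t _; rewrite lee_fin powR_ge0.
    - by rewrite in_itv/= leey andbT mule_ge0// poweR_ge0.
  rewrite poweRM ?poweR_ge0// -poweRrM mulfV ?gt_eqF// poweRe1//.
  by rewrite lee_wpmul2r ?poweR_ge0.
(* Case p = [+oo]. The essential supremum is an infimum, so the argument uses a level [M] slightly
   above it, known to be essential, and lets the excess tend to 0. *)
rewrite /LpN in gp *.
have S0 : 0 <= esssupN g.
  by apply: le_ereal_inf_tmp => M /=; exact: esssupN_ge0.
have Sfin : esssupN g \is a fin_num by rewrite ge0_fin_numE.
apply/lee_addgt0Pr => e e0.
(* Dividing by [C + 1] gives [C * e' <= e] and stays meaningful when [C = 0]. *)
pose e' := (e / (C + 1))%R.
have e'0 : (0 < e')%R by rewrite divr_gt0// ltr_wpDl.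
pose M := (fine (esssupN g) + e')%R.
have M0 : (0 <= M)%R by rewrite addr_ge0 ?fine_ge0// ltW.
have HM : nnint (fun x => ((M%:E < `|g x|%:E)%E%:R : R)%:E) = 0.
  have : esssupN g < M%:E by rewrite /M EFinD fineK// lteDl// lte_fin.
  move=> /ereal_inf_lt[M' /= HM' M'M].
  by apply: (gt_nnint_mono mg mg _ HM') => x; exact: lt_trans.
have Hae : {ae mu, forall y, Kabs k (g \o rt) y <= (C * M)%:E}.
  by apply: Kabs_ae_le => //; move: HM; rewrite gt_set_nnint.
apply: (@le_trans _ _ (C * M)%:E).
  apply: ereal_inf_lbound => /=; rewrite gt_set_nnint//.
  transitivity (\int[mu]_t (cst 0 t : \bar R)); last by rewrite integral0.
  apply: ge0_ae_eq_integral => //.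
  - by apply/measurable_EFinP; exact: (rmeas_gt (C * M)%:E mF).
  - apply: filterS Hae => t Ht _; rewrite avg_rowt.
    have := le_trans (abs_Kop_le mk k0 t mg) Ht.
    by rewrite leNgt => /negbTE ->.
rewrite /M mulrDr EFinD EFinM fineK// leeD2l// lee_fin /e' mulrCA ger_pMr//.
by rewrite ler_pdivrMr ?mul1r ?lerDl// ltr_wpDl.
Qed.

Lemma inLp_avg g : inLp p g -> inLp p (avg g).
Proof.
move=> Hg; have [mg gp] := Hg; split; first exact: rmeas_avg.
apply: le_lt_trans (LpN_avg Hg) _; rewrite lte_mul_pinfty//.
Qed.

(** For finite r, the elementary bound s x <= s + x^r for 0 <= s <= 1 (treat x <= 1 and x > 1 apart)
    reduces the claim to the volume of the box and the [L^r] bound. For p = [+oo] the average is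
    essentially bounded. *)
Lemma Kabs_box_lty g (b : R) : inLp p g ->
  \int[mu]_y (Kabs k (g \o rt) y * (boxf b y)%:E) < +oo.
Proof.
move=> [mg gp].
have mKb : measurable_fun setT (fun y => Kabs k (g \o rt) y * (boxf b y)%:E).
  apply: emeasurable_funM; first exact: (measurable_Kabs mk k0 mg).
  by apply/measurable_EFinP; exact: measurable_boxf.
have mb : measurable_fun setT (fun y : N.-tuple R => (boxf b y)%:E).
  by apply/measurable_EFinP; exact: measurable_boxf.
have Kb0 y : 0 <= Kabs k (g \o rt) y * (boxf b y)%:E.
  by rewrite mule_ge0 ?Kabs_ge0// lee_fin boxf_ge0.
move: p1 HC gp; case: p => [r| |] // r1 HCr gp.
  have {}r1 : (1 <= r)%R by move: r1; rewrite lee_fin.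
  have r0 : (0 < r)%R by move: r1; exact: lt_le_trans.
  have mKr : measurable_fun setT (fun y => (Kabs k (g \o rt) y) `^ r).
    exact: (measurableT_comp (measurable_poweR _) (measurable_Kabs mk k0 mg)).
  apply: (@le_lt_trans _ _ (\int[mu]_y ((boxf b y)%:E + (Kabs k (g \o rt) y) `^ r))).
    apply: ge0_le_integral => //.
    - exact: emeasurable_funD.
    - move=> y _; have := Kabs_ge0 k0 (g \o rt) y; have := boxf_ge0 b y; have := boxf_le1 b y.
      move: (boxf b y) => s s1 s0; case: (Kabs k (g \o rt) y) => [x| |]//.
      + rewrite lee_fin => x0; rewrite poweR_EFin -EFinM -EFinD lee_fin.
        have [x1|x1] := leP x 1%R.
          apply: (@le_trans _ _ s); first by rewrite ler_piMl.
          by rewrite lerDl powR_ge0.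
        apply: (@le_trans _ _ x); first by rewrite ler_piMr.
        apply: (@le_trans _ _ (x `^ r)%R); first by apply: le1r_powR => //; exact: ltW.
        by rewrite lerDr.
      + by move=> _; rewrite poweRyr ?gt_eqF// addey// leey.
  rewrite ge0_integralD//; last 2 first.
  - by move=> y _; rewrite lee_fin boxf_ge0.
  - by move=> y _; rewrite poweR_ge0.
  rewrite lte_add_pinfty ?integral_boxf_lty//.
  apply: le_lt_trans (integral_poweR_Kabs mk k0 kN r1 mg) _.
  apply: lte_mul_pinfty; first exact: poweR_ge0.
    apply: fin_num_poweR; rewrite ge0_fin_numE ?Kcst_ge0//.
    exact: le_lt_trans HCr (ltry _).
  move: gp; rewrite LpN_finE//; apply: lty_poweRy.
  by rewrite invr_neq0// gt_eqF.
have : exists2 M : R, (0 <= M)%R & nnint (fun x => ((M%:E < `|g x|%:E)%E%:R : R)%:E) = 0.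
  move: gp; rewrite /LpN => /ereal_inf_lt[M' /= HM' M'y].
  have M'0 := esssupN_ge0 mg HM'.
  exists (fine M'); first exact: fine_ge0.
  by rewrite fineK// ge0_fin_numE.
move=> [M M0 HM].
have Hae : {ae mu, forall y, Kabs k (g \o rt) y <= (C * M)%:E}.
  by apply: Kabs_ae_le => //; move: HM; rewrite gt_set_nnint.
apply: (@le_lt_trans _ _ (\int[mu]_y ((C * M)%:E * (boxf b y)%:E))).
  apply: ae_ge0_le_integral => //.
  - by move=> y _; rewrite mule_ge0 ?lee_fin ?mulr_ge0 ?boxf_ge0.
  - exact: measurable_funeM.
  - apply: filterS Hae => y Hy _; rewrite lee_wpmul2r// lee_fin boxf_ge0//.
rewrite ge0_integralZl//; last 2 first.
- by move=> y _; rewrite lee_fin boxf_ge0.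
- by rewrite lee_fin mulr_ge0.
by rewrite lte_mul_pinfty ?integral_boxf_lty// lee_fin mulr_ge0.
Qed.

(** A continuous [psi] vanishing off a compact set is dominated by a constant times the indicator of
    a box, so [Kabs_box_lty] provides the absolute convergence that [Kop_duality] demands. *)
Lemma avg_duality g psi (K : set (pt G)) : inLp p g -> compact K -> continuous psi ->
  (forall x, ~ K x -> psi x = 0%R) ->
  has_int (fun x => g x * wint k (fun t => psi (t *: x)))%R
          (intN (fun x => avg g x * psi x)%R).
Proof.
move=> Hg cK cpsi psi0; have [mg gp] := Hg.
have [M M0 HM] := continuous_bounded cK cpsi psi0.
have [b b0 Hb] := compact_coord_bounded cK.
have mpsi := continuous_rmeas cpsi.
have Hfin : \int[mu]_y (Kabs k (g \o rt) y * `|(psi \o rt) y|%:E) < +oo.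
  apply: (@le_lt_trans _ _ (\int[mu]_y (M%:E * (Kabs k (g \o rt) y * (boxf b y)%:E)))).
    have mKa := measurable_Kabs mk k0 mg.
    apply: ge0_le_integral => //.
    - by move=> y _; rewrite mule_ge0 ?Kabs_ge0.
    - by apply: emeasurable_funM => //; apply/measurable_EFinP; exact: (rmeas_norm mpsi).
    - apply: measurable_funeM; apply: emeasurable_funM => //.
      by apply/measurable_EFinP; exact: measurable_boxf.
    - move=> y _; rewrite muleCA lee_wpmul2l ?Kabs_ge0// -EFinM lee_fin.
      have [Ky|Ky] := pselect (K (rt y)); last first.
        by rewrite /= psi0// normr0 mulr_ge0 ?boxf_ge0// ltW.
      rewrite boxf_in ?mulr1//= => i; by have := Hb _ Ky i; rewrite mxE.
  rewrite ge0_integralZl//; last 3 first.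
  - apply: emeasurable_funM; first exact: (measurable_Kabs mk k0 mg).
    by apply/measurable_EFinP; exact: measurable_boxf.
  - by move=> y _; rewrite mule_ge0 ?Kabs_ge0// lee_fin boxf_ge0.
  - by rewrite lee_fin ltW.
  by rewrite lte_mul_pinfty ?Kabs_box_lty// lee_fin ltW.
have [I1 I2 E] := Kop_duality mk k0 kN mg mpsi Hfin.
have wE x : wint k (fun t => (psi \o rt) (tscale t x)) = wint k (fun t => psi (t *: rt x)%R).
  by congr wint; apply/funext => t /=; rewrite rowt_tscale.
have H1 : has_int (fun x => avg g x * psi x)%R (\int[mu]_t (avg g (rt t) * psi (rt t)))%R.
  split=> //; apply: eq_integrable I1 => // t _.
  by rewrite avg_rowt.
rewrite (has_int_intN H1); split.
  by apply: eq_integrable I2 => // t _; rewrite wE.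
rewrite /Rintegral; congr fine.
transitivity (\int[mu]_y (Kop k (g \o rt) y * (psi \o rt) y)%:E).
  by rewrite E; apply: eq_integral => t _; rewrite wE.
by apply: eq_integral => t _; rewrite avg_rowt.
Qed.

End averaging_Lp.

(** * The three Taylor kernels and their constants *)

Section kernels.
Context (R : realType).
Local Notation leb := (@lebesgue_measure R).

Definition kinner1 : R -> R := kpos (fun=> 1).
Definition kinner2 : R -> R := kpos (fun t => 1 - t).
Definition kouter : R -> R := (fun t : R => t - 1) \_ `[1, +oo[%classic.

Lemma restrict_weightP (w : R -> R) (D : set R) :
  measurable D -> continuous w -> (forall t, D t -> 0 < t /\ 0 <= w t) ->
  [/\ measurable_fun setT (w \_ D), (forall t, 0 <= (w \_ D) t) &
      (forall t, t <= 0 -> (w \_ D) t = 0)].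
Proof.
move=> mD cw H; split.
- apply/(measurable_restrictT _ mD); apply: measurable_funTS.
  exact: continuous_measurable_fun.
- by move=> t; rewrite patchE; case: ifPn => // /set_mem /H [].
- move=> t t0; rewrite patchE; case: ifPn => // /set_mem /H [] /lt_geF.
  by rewrite t0.
Qed.

Lemma kinner1P : [/\ measurable_fun setT kinner1, (forall t, 0 <= kinner1 t) & (forall t, t <= 0 -> kinner1 t = 0)].
Proof.
apply: restrict_weightP => //; first exact: cts_cst.
by move=> t /=; rewrite in_itv/= => /andP[].
Qed.

Lemma kinner2P : [/\ measurable_fun setT kinner2, (forall t, 0 <= kinner2 t) & (forall t, t <= 0 -> kinner2 t = 0)].
Proof.
apply: restrict_weightP => //; first exact: cts_onem.
by move=> t /=; rewrite in_itv/= subr_ge0 => /andP[].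
Qed.

Lemma kouterP : [/\ measurable_fun setT kouter, (forall t, 0 <= kouter t) & (forall t, t <= 0 -> kouter t = 0)].
Proof.
apply: restrict_weightP => //; first exact: cts_subr1.
by move=> t /=; rewrite in_itv/= andbT subr_ge0 => t1; split=> //; exact: lt_le_trans t1.
Qed.

Local Open Scope ereal_scope.

Lemma Kcst_kpos (m : nat) (q : R) (w : R -> R) : continuous w ->
  (forall t, 0 < t -> t <= 1 -> 0 <= w t <= 1)%R -> (m%:R - m%:R * q < 1)%R ->
  Kcst m (kpos w) q <= ((1 - (m%:R - m%:R * q))^-1)%:E.
Proof.
move=> cw Hw a1; apply: le_trans (integral_powR_0_1 a1).
have := @Kcst_restrict_le R m w `]0%R, 1%R]%classic q 0%R.
rewrite opprB sub0r addrC; apply => //; first exact: continuous_measurable_fun.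
move=> t /=; rewrite in_itv/= powRr0 => /andP[t0 t1]; split=> //; exact: Hw.
Qed.

(** The bound t - 1 <= t costs one power of t, which turns the threshold 1 for integrability at
    infinity into 2. *)
Lemma Kcst_kouter (m : nat) (q : R) : (2 < m%:R - m%:R * q)%R ->
  Kcst m kouter q <= ((m%:R - m%:R * q - 2)^-1)%:E.
Proof.
move=> a2.
have a1 : (1 < m%:R - m%:R * q - 1)%R by rewrite ltrBrDr.
have -> : (m%:R - m%:R * q - 2 = m%:R - m%:R * q - 1 - 1 :> R)%R by ring.
apply: le_trans (integral_powR_1_infty a1).
have := @Kcst_restrict_le R m (fun t => t - 1)%R `[1%R, +oo[%classic q 1%R.
rewrite (_ : - (m%:R - m%:R * q - 1) = 1 - m%:R + m%:R * q)%R; last by ring.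
apply => //; first by apply: continuous_measurable_fun; exact: cts_subr1.
move=> t /=; rewrite in_itv/= andbT => t1.
have t0 : (0 < t)%R by exact: lt_le_trans t1.
by split=> //; rewrite subr_ge0 t1 /= powRr1 ?(ltW t0)// gerBl.
Qed.

End kernels.

(** * Taylor expansions on the group *)

Section taylor.
Context (R : realType) (G : carnot R).
Implicit Types (phi psi : pt G -> R).

Lemma homdim_ge : (cN G <= homdim G)%N.
Proof.
rewrite /homdim -[X in (X <= _)%N]card_ord -sum1_card; apply: leq_sum => i _.
by have /andP[] := cw_range i.
Qed.

Lemma homdim_le : (homdim G <= cN G * cs G)%N.
Proof.
rewrite /homdim -[X in (_ <= X * _)%N]card_ord -sum_nat_const; apply: leq_sum => i _.
by have /andP[] := cw_range i.
Qed.

Lemma cN_gt0 : (0 < cN G)%N.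
Proof. by have [i _] := cVs_neq0 G; exact: leq_ltn_trans (ltn_ord i). Qed.

Lemma continuous_ray psi (x : pt G) : continuous psi ->
  continuous (fun t : R => psi (t *: x)).
Proof.
move=> cpsi t; apply: (@continuous_comp _ _ _ (fun t : R => t *: x) psi).
  exact: scalel_continuous.
exact: cpsi.
Qed.

Lemma ray_Xop psi (x : pt G) : smoothk 1 psi -> forall t : R,
  is_derive t 1 (fun s : R => psi (s *: x)) (\sum_i x ord0 i * Xop i psi (t *: x)).
Proof. by move=> [dpsi _] t; apply: is_derive_ray; exact: dpsi. Qed.

Lemma continuous_sum_ray (psi : 'I_(cN G) -> pt G -> R) (x : pt G) :
  (forall i, continuous (psi i)) ->
  continuous (fun t : R => \sum_i x ord0 i * psi i (t *: x)).
Proof.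
move=> cpsi; apply: continuous_big; first exact: add_continuous.
move=> i _ t; apply: cvgM; first exact: cvg_cst.
exact: (continuous_ray (cpsi i)).
Qed.

Lemma integrable_kpos_ray (w : R -> R) psi (x : pt G) : continuous w -> continuous psi ->
  lebesgue_measure.-integrable setT (fun t => (kpos w t * psi (t *: x))%:E).
Proof.
move=> cw cpsi; apply: (@integrable_weight R `]0, 1]%classic w _ 0 1) => //.
  exact: continuous_ray.
move=> t /= t01 nt; exfalso; apply: nt; move: t01; rewrite /= !in_itv/=.
by move=> /andP[/ltW -> ->].
Qed.

(* First order expansion at the origin; the terms of the horizontal directions
   are expanded once more. *)
Lemma taylor_origin phi (x : pt G) : smoothk 2 phi ->
  phi x = phi 0 + \sum_(i < cN G | (i < cn G)%N) x ord0 i * Xop i phi 0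
   + \sum_(i < cN G) \sum_(j < cN G) ((i < cn G)%N%:R * (x ord0 i * x ord0 j)) *
        wint (@kinner2 R) (fun t => Xop j (Xop i phi) (t *: x))
   + \sum_(i < cN G | (cn G <= i)%N) x ord0 i *
        wint (@kinner1 R) (fun t => Xop i phi (t *: x)).
Proof.
move=> s2; have s1 i : smoothk 1 (Xop i phi) by exact: smoothk_Xop.
have s0 i j : continuous (Xop j (Xop i phi)).
  by apply: (smoothk_continuous (k := 0)); exact: smoothk_Xop.
have c1 i : continuous (Xop i phi) by exact: smoothk_continuous (s1 i).
have E1 := wint_taylor1 (continuous_sum_ray (x := x) c1) (ray_Xop x (smoothkS s2)).
rewrite scale1r scale0r (wint_sum (k := kpos (fun=> 1)) (fun i => x ord0 i)
  (fun i => integrable_kpos_ray x (@cts_cst R 1) (c1 i))) in E1.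
have E2 i : wint (@kinner1 R) (fun t => Xop i phi (t *: x)) = Xop i phi 0 +
    \sum_j x ord0 j * wint (@kinner2 R) (fun t => Xop j (Xop i phi) (t *: x)).
  rewrite /kinner1 (wint_taylor2 (continuous_sum_ray (x := x) (s0 i)) (ray_Xop x (s1 i))).
  by rewrite scale0r (wint_sum (k := kpos (fun t => 1 - t)) (fun j => x ord0 j)
    (fun j => integrable_kpos_ray x (@cts_onem R) (s0 i j))).
rewrite -[LHS](subrK (phi 0)) -E1 addrC -!addrA; congr (_ + _).
rewrite (bigID (fun i : 'I_(cN G) => (i < cn G)%N))/= addrA; congr (_ + _); last first.
  by apply: eq_bigl => i; rewrite -leqNgt.
rewrite [X in _ = _ + X](bigID (fun i : 'I_(cN G) => (i < cn G)%N))/= [X in _ = _ + (_ + X)]big1.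
  rewrite addr0 -big_split/=; apply: eq_bigr => i ni.
  rewrite -[wint _ _]/(wint (@kinner1 R) (fun t => Xop i phi (t *: x))) E2 mulrDr; congr (_ + _).
  by rewrite mulr_sumr; apply: eq_bigr => j _; rewrite ni mul1r mulrA.
by move=> i /negbTE ni; rewrite big1// => j _; rewrite ni !mul0r.
Qed.

(** For x other than 0 the ray eventually leaves [K], so there are no boundary terms at infinity. At
    the origin the right-hand side is 0 whatever [phi 0] is, hence the exclusion; that point is
    discarded later as a null set. *)
Lemma taylor_infinity phi (K : set (pt G)) (x : pt G) : smoothk 2 phi -> compact K ->
  closed K -> (forall y, ~ K y -> phi y = 0) -> x != 0 ->
  phi x = \sum_i \sum_j (x ord0 i * x ord0 j) *
        wint (@kouter R) (fun t => Xop j (Xop i phi) (t *: x)).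
Proof.
move=> s2 cK clK phi0 xn0; have s1 i : smoothk 1 (Xop i phi) by exact: smoothk_Xop.
have s0 i j : continuous (Xop j (Xop i phi)).
  by apply: (smoothk_continuous (k := 0)); exact: smoothk_Xop.
have c1 i : continuous (Xop i phi) by exact: smoothk_continuous (s1 i).
have X0 i := Xop_eq0 i clK phi0.
have XX0 i j := Xop_eq0 j clK (X0 i).
have [M M0 HM] := compact_coord_bounded cK.
have [l xl] : exists l, x ord0 l != 0.
  apply/existsP; rewrite -negb_forall; apply: contra xn0 => /forallP H.
  by apply/eqP/rowP => l; rewrite mxE; apply/eqP.
have al : 0 < `|x ord0 l| by rewrite normr_gt0.
(* Past this time the coordinate [l] of [t *: x] is at least [M + 1] in absolute value, beyond the
   bound [M] on [K]; the 2 ensures [1 < T]. *)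
pose T := Num.max 2 ((M + 1) / `|x ord0 l|).
have T1 : 1 < T by rewrite lt_max ltr1n.
have outT t : T <= t -> ~ K (t *: x).
  move=> Tt /HM /(_ l); rewrite mxE normrM => h.
  have t0 : 0 < t by apply: lt_le_trans Tt; exact: lt_trans T1.
  move: h; rewrite (ger0_norm (ltW t0)) => h.
  have : (M + 1) / `|x ord0 l| <= t by apply: le_trans Tt; rewrite le_max lexx orbT.
  rewrite ler_pdivrMr// => /le_trans /(_ h); rewrite leNgt => /negP; apply.
  by rewrite ltrDl.
have Iray psi : continuous psi -> (forall y, ~ K y -> psi y = 0) ->
    lebesgue_measure.-integrable setT (fun t => (kouter t * psi (t *: x))%:E).
  move=> cpsi psi0; apply: (@integrable_weight R `[1, +oo[%classic _ _ 1 T) => //.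
  - exact: cts_subr1.
  - exact: continuous_ray.
  - move=> t /=; rewrite in_itv/= andbT => t1 nt; apply: psi0; apply: outT.
    by rewrite leNgt; apply/negP => /ltW tT; apply: nt; rewrite in_itv/= t1.
pose dd i t := \sum_j x ord0 j * Xop j (Xop i phi) (t *: x).
have Ddu (t : R) : is_derive t 1 (fun s : R => \sum_i x ord0 i * Xop i phi (s *: x))
    (\sum_i x ord0 i * dd i t).
  have D i : is_derive t 1 (fun s : R => x ord0 i * Xop i phi (s *: x)) (x ord0 i * dd i t).
    have D0 := ray_Xop x (s1 i) t.
    exact: (@is_deriveZ _ _ _ (fun s : R => Xop i phi (s *: x)) (x ord0 i)).
  have := @is_derive_sum _ _ _ _ (fun i (s : R) => x ord0 i * Xop i phi (s *: x)) t 1 _ D.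
  rewrite (_ : \sum_(i < _) _ = fun s : R => \sum_i x ord0 i * Xop i phi (s *: x))//.
  by apply/funext => s; rewrite fct_sumE.
have cdd i : continuous (dd i) by exact: (continuous_sum_ray (x := x) (s0 i)).
have cddu : continuous (fun t : R => \sum_i x ord0 i * dd i t).
  apply: continuous_big; first exact: add_continuous.
  by move=> i _ t; apply: cvgM; [exact: cvg_cst|exact: cdd].
have := wint_infty cddu (ray_Xop x (smoothkS s2)) Ddu T1.
rewrite scale1r => <-; last first.
  move=> t /outT Kt; split; first exact: phi0.
  split; first by rewrite big1// => i _; rewrite X0// mulr0.
  by rewrite big1// => i _; rewrite /dd big1 ?mulr0// => j _; rewrite XX0// mulr0.
have -> : (fun t : R => \sum_i x ord0 i * dd i t) =
    (fun t : R => \sum_(ij : 'I_(cN G) * 'I_(cN G)) (x ord0 ij.1 * x ord0 ij.2) * Xop ij.2 (Xop ij.1 phi) (t *: x)).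
  apply/funext => t; rewrite -(pair_bigA _ (fun i j => (x ord0 i * x ord0 j) * Xop j (Xop i phi) (t *: x)))/=.
  by apply: eq_bigr => i _; rewrite mulr_sumr; apply: eq_bigr => j _; rewrite mulrA.
rewrite (wint_sum (fun ij : 'I_(cN G) * 'I_(cN G) => x ord0 ij.1 * x ord0 ij.2)).
  by rewrite -(pair_bigA _ (fun i j => (x ord0 i * x ord0 j) * wint (@kouter R) (fun t => Xop j (Xop i phi) (t *: x)))).
by move=> [i j] /=; apply: Iray; [exact: s0|exact: XX0].
Qed.

End taylor.

(** * The two decompositions *)

Section decomposition.
Context (R : realType) (G : carnot R).
Local Notation N := (cN G).
Implicit Types (f g phi psi : pt G -> R).

Lemma coord_le_normR (x : pt G) i : `|x ord0 i| <= normR x.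
Proof.
rewrite -sqrtr_sqr /normR ler_wsqrtr// (bigD1 i)//= lerDl.
by apply: sumr_ge0 => j _; exact: sqr_ge0.
Qed.

Lemma normR_ge0 (x : pt G) : 0 <= normR x.
Proof. exact: sqrtr_ge0. Qed.

Lemma rmeas_normR : rmeas (@normR R G).
Proof.
apply: continuous_rmeas => x.
apply: (@continuous_comp _ _ _ (fun x : pt G => \sum_i x ord0 i ^+ 2) Num.sqrt); last exact: sqrt_continuous.
apply: (smoothk_continuous (k := 0)); apply: smoothk_sum => i _.
by apply: smoothkM; exact: smoothk_coord.
Qed.

Lemma LpN_ge0 (p : \bar R) f : (1 <= p)%E -> rmeas f -> (0 <= LpN p f)%E.
Proof.
case: p => [r| |] // _ mf; first exact: poweR_ge0.
by rewrite /LpN; apply: le_ereal_inf_tmp => M /=; exact: esssupN_ge0.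
Qed.

(** The constant [c] lets one lemma serve both cases: it is the indicator of [i < n] near the origin
    and 1 at infinity. In the linear analogue it carries a sign. *)
Lemma rmeas_quad f (c : R) i j : rmeas f ->
  rmeas (fun x => (c * (x ord0 i * x ord0 j)) * f x).
Proof.
move=> mf; apply: rmeasM => //; apply: rmeasM; first exact: rmeas_cst.
by apply: rmeasM; exact: rmeas_coord.
Qed.

Lemma quad_le f (c : R) i j (x : pt G) : `|c| <= 1 ->
  `|(c * (x ord0 i * x ord0 j)) * f x| <= `|normR x ^+ 2 * f x|.
Proof.
move=> c1; rewrite !normrM ler_wpM2r//.
rewrite (ger0_norm (normR_ge0 x)) -[leRHS]mul1r.
by rewrite ler_pM// ?mulr_ge0// ler_pM// coord_le_normR.
Qed.

Lemma rmeas_lin f (c : R) i : rmeas f -> rmeas (fun x => (c * x ord0 i) * f x).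
Proof.
move=> mf; apply: rmeasM => //; apply: rmeasM; first exact: rmeas_cst.
exact: rmeas_coord.
Qed.

Lemma lin_le f (c : R) i (x : pt G) : `|c| <= 1 ->
  `|(c * x ord0 i) * f x| <= `|normR x * f x|.
Proof.
move=> c1; rewrite !normrM ler_wpM2r// (ger0_norm (normR_ge0 x)) -[leRHS]mul1r.
by rewrite ler_pM// coord_le_normR.
Qed.

Lemma test_funP phi : test_fun phi -> exists K : set (pt G),
  [/\ compact K, closed K, smoothk 2 phi & forall x, ~ K x -> phi x = 0].
Proof.
move=> [sphi cK]; exists (closure [set x | phi x != 0]); split=> //.
  exact: closed_closure.
move=> x; apply: contra_notP => /eqP px; exact: subset_closure.
Qed.

Lemma avg_duality_XX (p : \bar R) (k : R -> R) (C : R) g phi (K : set (pt G)) (i j : 'I_N) :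
  [/\ measurable_fun setT k, (forall t, 0 <= k t) & (forall t, t <= 0 -> k t = 0)] ->
  (1 <= p)%E -> 0 <= C -> (Kcst N k (invexp p) <= C%:E)%E -> inLp p g ->
  compact K -> closed K -> smoothk 2 phi -> (forall x, ~ K x -> phi x = 0) ->
  has_int (fun x => g x * wint k (fun t => Xop j (Xop i phi) (t *: x)))
          (intN (fun x => avg k g x * Xop j (Xop i phi) x)).
Proof.
move=> [mk k0 kN] p1 C0 HC Hg cK clK s2 phi0.
apply: (avg_duality mk k0 kN p1 C0 HC Hg cK).
  by apply: (smoothk_continuous (k := 0)); do 2 apply: smoothk_Xop.
by apply: Xop_eq0 => //; exact: Xop_eq0.
Qed.

Lemma avg_duality_X (p : \bar R) (k : R -> R) (C : R) g phi (K : set (pt G)) (i : 'I_N) :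
  [/\ measurable_fun setT k, (forall t, 0 <= k t) & (forall t, t <= 0 -> k t = 0)] ->
  (1 <= p)%E -> 0 <= C -> (Kcst N k (invexp p) <= C%:E)%E -> inLp p g ->
  compact K -> closed K -> smoothk 2 phi -> (forall x, ~ K x -> phi x = 0) ->
  has_int (fun x => g x * wint k (fun t => Xop i phi (t *: x)))
          (intN (fun x => avg k g x * Xop i phi x)).
Proof.
move=> [mk k0 kN] p1 C0 HC Hg cK clK s2 phi0.
apply: (avg_duality mk k0 kN p1 C0 HC Hg cK).
  by apply: (smoothk_continuous (k := 1)); apply: smoothk_Xop.
exact: Xop_eq0.
Qed.

(** Multiply [taylor_origin] by [f] and integrate term by term: the values at the origin yield the
    moments of [f], and duality turns each remainder into a pairing with an average of x_i x_j f or
    x_i f. *)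
Lemma decomposition_subcritical (r : R) : 1 <= r ->
  r * ((homdim G)%:R - 1) < (homdim G)%:R ->
  exists C : R, 0 < C /\
    forall f : pt G -> R,
      loc_int f ->
      (nnint (fun x => (`|f x| * (1 + normR x))%:E) < +oo)%E ->
      inLp r%:E (fun x => normR x * f x) ->
      inLp r%:E (fun x => normR x ^+ 2 * f x) ->
      exists (F2 : 'I_(cN G) -> 'I_(cN G) -> pt G -> R)
             (F1 : 'I_(cN G) -> pt G -> R),
        (forall i j, inLp r%:E (F2 i j)) /\
        (forall i : 'I_(cN G), (cn G <= i)%N -> inLp r%:E (F1 i)) /\
        (forall phi : pt G -> R, test_fun phi ->
           intN (fun x => f x * phi x) =
             intN f * phi 0
           + \sum_(i < cN G | (i < cn G)%N)
                intN (fun x => f x * x ord0 i) * Xop i phi 0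
           + \sum_i \sum_j intN (fun x => F2 i j x * Xop j (Xop i phi) x)
           - \sum_(i < cN G | (cn G <= i)%N) intN (fun x => F1 i x * Xop i phi x)) /\
        (forall i j,
           (LpN r%:E (F2 i j) <= C%:E * LpN r%:E (fun x => (normR x ^+ 2 * f x)%R))%E) /\
        (forall i : 'I_(cN G), (cn G <= i)%N ->
           (LpN r%:E (F1 i) <= C%:E * LpN r%:E (fun x => (normR x * f x)%R))%E).
Proof.
move=> r1 rQ.
have r0 : 0 < r by exact: lt_le_trans r1.
have p1 : (1 <= r%:E)%E by rewrite lee_fin.
(* The hypothesis says Q (1 - 1/r) < 1; as 1 - 1/r >= 0, replacing Q by the smaller N keeps it. *)
have a1 : N%:R - N%:R * r^-1 < 1.
  have NQ : N%:R <= (homdim G)%:R :> R by rewrite ler_nat homdim_ge.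
  have h : 0 <= 1 - r^-1 by rewrite subr_ge0 invf_le1.
  apply: (@le_lt_trans _ _ ((homdim G)%:R * (1 - r^-1))).
    by rewrite -[X in X - _]mulr1 -mulrBr ler_wpM2r.
  rewrite -(ltr_pM2l r0) mulr1.
  rewrite (_ : r * _ = (homdim G)%:R * (r - 1)); last by field; rewrite gt_eqF.
  by move: rQ; rewrite !mulrBr mulr1 => H; lra.
pose C := (1 - (N%:R - N%:R * r^-1))^-1 : R.
have C0 : 0 < C by rewrite invr_gt0 subr_gt0.
have HC1 : (Kcst N (@kinner1 R) (invexp r%:E) <= C%:E)%E.
  apply: Kcst_kpos => //; first exact: cts_cst.
  by move=> t _ _; rewrite ler01 lexx.
have HC2 : (Kcst N (@kinner2 R) (invexp r%:E) <= C%:E)%E.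
  apply: Kcst_kpos => //; first exact: cts_onem.
  by move=> t t0 t1; rewrite subr_ge0 t1 gerBl ltW.
exists C; split=> // f [mf _] fint nf1 nf2.
pose g2 (i j : 'I_N) (x : pt G) := ((i < cn G)%N%:R * (x ord0 i * x ord0 j)) * f x.
(* The factor -1 compensates the sign in the pairing of X^i F_i with [phi], which is minus the
   integral of F_i X^i phi. *)
pose g1 (i : 'I_N) (x : pt G) := (-1 * x ord0 i) * f x.
have b1 (i : 'I_N) : `|((i < cn G)%N%:R : R)| <= 1 by case: (_ < _)%N; rewrite ?normr1 ?normr0.
have b2 : `|-1 : R| <= 1 by rewrite normrN1.
have m2 i j : rmeas (g2 i j) by exact: rmeas_quad.
have m1 i : rmeas (g1 i) by exact: rmeas_lin.
have L2 i j : inLp r%:E (g2 i j).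
  by apply: (inLp_mono p1 _ nf2) => // x; exact: quad_le.
have L1 i : inLp r%:E (g1 i).
  by apply: (inLp_mono p1 _ nf1) => // x; exact: lin_le.
have [mk1 k10 k1N] := kinner1P R; have [mk2 k20 k2N] := kinner2P R.
exists (fun i j => avg (@kinner2 R) (g2 i j)), (fun i => avg (@kinner1 R) (g1 i)).
split; [|split; [|split; [|split]]].
- by move=> i j; apply: (inLp_avg mk2 k20 k2N p1 (ltW C0) HC2).
- by move=> i _; apply: (inLp_avg mk1 k10 k1N p1 (ltW C0) HC1).
- move=> phi /test_funP[K [cK clK s2 phi0]].
  have mfn : rmeas (fun x => `|f x| * (1 + normR x)).
    apply: rmeasM; first exact: rmeas_norm.
    exact: (measurable_funD (rmeas_cst (G := G) 1) rmeas_normR).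
  have H0 : has_int f (intN f).
    apply: (has_int_bound mf mfn _ fint) => x.
    by rewrite ler_peMr// lerDl normR_ge0.
  have Hx i : has_int (fun x => f x * x ord0 i) (intN (fun x => f x * x ord0 i)).
    apply: (has_int_bound _ mfn _ fint); first by apply: rmeasM => //; exact: rmeas_coord.
    move=> x; rewrite normrM ler_wpM2l//; apply: le_trans (coord_le_normR x i) _.
    by rewrite lerDr.
  have H2 i j := avg_duality_XX i j (kinner2P R) p1 (ltW C0) HC2 (L2 i j) cK clK s2 phi0.
  have H1 i := avg_duality_X i (kinner1P R) p1 (ltW C0) HC1 (L1 i) cK clK s2 phi0.
  (* [HH] collects the integrability of every term of the expansion; that of [f phi] follows since
     the sum equals it pointwise. *)
  have HH := has_intD (has_intD (has_intD (has_intZ (phi 0) H0)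
    (has_int_sum (index_enum 'I_N) (fun i _ => has_intZ (Xop i phi 0) (Hx i))
      (P := fun i => (i < cn G)%N)))
    (has_int_sum (index_enum 'I_N) (fun i _ => has_int_sum (index_enum 'I_N) (fun j _ => H2 i j) (P := xpredT)) (P := xpredT)))
    (has_intZ (-1) (has_int_sum (index_enum 'I_N) (fun i _ => H1 i) (P := fun i => (cn G <= i)%N))).
  rewrite (has_int_intN (f := fun x => f x * phi x) (has_int_eq _ HH)).
    congr (_ + _ + _ + _); first by rewrite mulrC.
      by apply: eq_bigr => i _; rewrite mulrC.
    by rewrite mulN1r.
  move=> x; rewrite /= [in RHS](taylor_origin x s2) !mulrDr.
  congr (_ + _ + _ + _); first by rewrite mulrC.
  + by rewrite mulr_sumr; apply: eq_bigr => i _; ring.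
  + rewrite mulr_sumr; apply: eq_bigr => i _; rewrite mulr_sumr; apply: eq_bigr => j _.
    by rewrite /g2; ring.
  + rewrite mulr_sumr mulr_sumr; apply: eq_bigr => i _; rewrite /g1; ring.
- move=> i j; apply: le_trans (LpN_avg mk2 k20 k2N p1 (ltW C0) HC2 (L2 i j)) _.
  apply: lee_wpmul2l; first by rewrite lee_fin ltW.
  by apply: LpN_mono => //; [case: nf2|move=> x; exact: quad_le].
- move=> i _; apply: le_trans (LpN_avg mk1 k10 k1N p1 (ltW C0) HC1 (L1 i)) _.
  apply: lee_wpmul2l; first by rewrite lee_fin ltW.
  by apply: LpN_mono => //; [case: nf1|move=> x; exact: lin_le].
Qed.

(** The discrepancy at the origin is a multiple of [boxf 0], whose integral is 0; adding that
    multiple to [g] gives [f]. *)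
Lemma has_int_off0 f g v : (forall x, x != 0 -> f x = g x) -> has_int g v -> has_int f v.
Proof.
move=> fg Hg.
have Hb : has_int (fun x : pt G => boxf 0 (tupof x)) 0.
  have I0 := @integral_boxf0 R N (cN_gt0 G).
  have mb : measurable_fun setT (fun t : N.-tuple R => (boxf 0 t)%:E).
    by apply/measurable_EFinP; exact: measurable_boxf.
  have E : (fun t => (boxf 0 (tupof (@rowt R N t)))%:E) = (fun t : N.-tuple R => (boxf 0 t)%:E).
    by apply/funext => t; rewrite rowtK.
  split; last by rewrite /Rintegral E I0.
  rewrite E; apply/integrableP; split => //.
  under eq_integral do rewrite gee0_abs ?lee_fin ?boxf_ge0//.
  by rewrite I0 ltry.
have := has_intD Hg (has_intZ (f 0 - g 0) Hb); rewrite mulr0 addr0.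
apply: has_int_eq => x; have [->|x0] := eqVneq x 0.
  by rewrite boxf_in ?mulr1 ?subrKC// => i; rewrite tnth_mktuple mxE normr0.
have [i xi] : exists i, x ord0 i != 0.
  apply/existsP; rewrite -negb_forall; apply: contra x0 => /forallP H.
  by apply/eqP/rowP => l; rewrite mxE; apply/eqP.
rewrite (@boxf_out _ _ _ _ i) ?mulr0 ?addr0 ?fg//.
by rewrite tnth_mktuple normr_le0.
Qed.

Lemma decomposition_supercritical (p : \bar R) : (1 <= p)%E ->
  (2 * cs G < homdim G)%N ->
  (((homdim G)%:R / ((homdim G)%:R - 2 * (cs G)%:R))%:E < p)%E ->
  exists C : R, 0 < C /\
    forall f : pt G -> R,
      loc_int f ->
      inLp p (fun x => normR x * f x) ->
      inLp p (fun x => normR x ^+ 2 * f x) ->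
      exists (F2 : 'I_(cN G) -> 'I_(cN G) -> pt G -> R)
             (F1 : 'I_(cN G) -> pt G -> R),
        (forall i j, inLp p (F2 i j)) /\
        (forall i : 'I_(cN G), (cn G <= i)%N -> inLp p (F1 i)) /\
        (forall phi : pt G -> R, test_fun phi ->
           intN (fun x => f x * phi x) =
             \sum_i \sum_j intN (fun x => F2 i j x * Xop j (Xop i phi) x)
           - \sum_(i < cN G | (cn G <= i)%N) intN (fun x => F1 i x * Xop i phi x)) /\
        (forall i j,
           (LpN p (F2 i j) <= C%:E * LpN p (fun x => (normR x ^+ 2 * f x)%R))%E) /\
        (forall i : 'I_(cN G), (cn G <= i)%N ->
           (LpN p (F1 i) <= C%:E * LpN p (fun x => (normR x * f x)%R))%E).
Proof.
move=> p1 Qs pQ.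
have a2 : 2 < N%:R - N%:R * invexp p.
  have QN : (homdim G)%:R <= N%:R * (cs G)%:R :> R by rewrite -natrM ler_nat homdim_le.
  have s0 : 0 < (cs G)%:R :> R by rewrite ltr0n cs_gt0.
  have Qs' : 2 * (cs G)%:R < (homdim G)%:R :> R by rewrite -natrM ltr_nat.
  move: p1 pQ; case: p => [r| |] //= p1; last first.
    (* For p = [+oo] the claim is N > 2, which is 2 s < Q <= N s divided by s. *)
    by move=> _; rewrite mulr0 subr0 -(ltr_pM2r s0); exact: lt_le_trans QN.
  have r1 : 1 <= r by move: p1; rewrite lee_fin.
  have r0 : 0 < r by exact: lt_le_trans r1.
  rewrite lte_fin ltr_pdivrMr ?subr_gt0// => h.
  have h' : 0 <= r - 1 by rewrite subr_ge0.
  (* With denominators cleared the hypothesis reads 2 s r < Q (r - 1); then Q <= N s, and s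
     cancels. *)
  have : 2 * r < N%:R * (r - 1).
    rewrite -(ltr_pM2r s0); apply: (@lt_le_trans _ _ ((homdim G)%:R * (r - 1))).
      by rewrite mulrBr mulr1; rewrite mulrBr in h; lra.
    by rewrite mulrAC ler_wpM2r.
  move=> H2; rewrite -(ltr_pM2r r0).
  by rewrite (_ : (N%:R - N%:R * r^-1) * r = N%:R * (r - 1))//; field; rewrite gt_eqF.
(* The added 1 makes [C >= 1], which is used for the bound on the zero functions [F_i]: the norm of
   0 is compared first with that of |x| f, then with [C] times it. *)
pose C := (N%:R - N%:R * invexp p - 2)^-1 + 1 : R.
have C1 : 1 <= C by rewrite lerDr invr_ge0 subr_ge0 ltW.
have C0 : 0 < C by exact: lt_le_trans C1.
have HC : (Kcst N (@kouter R) (invexp p) <= C%:E)%E.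
  by apply: le_trans (Kcst_kouter a2) _; rewrite lee_fin lerDl.
exists C; split=> // f [mf _] nf1 nf2.
pose g2 (i j : 'I_N) (x : pt G) := (1 * (x ord0 i * x ord0 j)) * f x.
have b1 : `|1 : R| <= 1 by rewrite normr1.
have m2 i j : rmeas (g2 i j) by exact: rmeas_quad.
have L2 i j : inLp p (g2 i j).
  by apply: (inLp_mono p1 _ nf2) => // x; exact: quad_le.
have [mk3 k30 k3N] := kouterP R.
have m0 : rmeas (fun _ : pt G => 0 : R) by exact: rmeas_cst.
exists (fun i j => avg (@kouter R) (g2 i j)), (fun i => fun=> 0).
split; [|split; [|split; [|split]]].
- by move=> i j; apply: (inLp_avg mk3 k30 k3N p1 (ltW C0) HC).
- by move=> i _; apply: (inLp_mono p1 m0 nf1) => x; rewrite normr0.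
- move=> phi /test_funP[K [cK clK s2 phi0]].
  have H2 i j := avg_duality_XX i j (kouterP R) p1 (ltW C0) HC (L2 i j) cK clK s2 phi0.
  have HH := has_int_sum (index_enum 'I_N) (fun i _ => has_int_sum (index_enum 'I_N)
    (fun j _ => H2 i j) (P := xpredT)) (P := xpredT).
  rewrite (has_int_intN (f := fun x => f x * phi x) (has_int_off0 _ HH)).
    rewrite [X in _ = _ - X]big1 ?subr0// => i _.
    apply: has_int_intN; apply: has_int_eq (has_int0 G) => x.
    by rewrite mul0r.
  move=> x x0; rewrite /= [in LHS](taylor_infinity s2 cK clK phi0 x0).
  rewrite mulr_sumr; apply: eq_bigr => i _; rewrite mulr_sumr; apply: eq_bigr => j _.
  by rewrite /g2; ring.
- move=> i j; apply: le_trans (LpN_avg mk3 k30 k3N p1 (ltW C0) HC (L2 i j)) _.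
  apply: lee_wpmul2l; first by rewrite lee_fin ltW.
  by apply: LpN_mono => //; [case: nf2|move=> x; exact: quad_le].
- move=> i _; apply: (@le_trans _ _ (LpN p (fun x => normR x * f x))).
    by apply: LpN_mono => //; [case: nf1|move=> x; rewrite normr0].
  by rewrite lee_pemull ?lee_fin//; apply: LpN_ge0 => //; case: nf1.
Qed.

End decomposition.

(** The exponent condition of case (i) is multiplied out, so that for Q = 1 it allows every finite
    p. Tested against [phi], the term X^i X^j F_ij becomes the integral of F_ij X^j X^i phi with a
    plus sign, and -X^i applied to the Dirac mass becomes +(X^i phi)(0). The constant is chosen
    before [f]. *)
Theorem mainTheorem2 (R : realType) (G : carnot R) (p : \bar R)
    (hp : (1 <= p)%E) :
  (* (i) 1 <= p < Q/(Q-1) *)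
  ((forall r : R, p = r%:E -> r * ((homdim G)%:R - 1) < (homdim G)%:R ->
    exists C : R, 0 < C /\
    forall f : pt G -> R,
      loc_int f ->
      (nnint (fun x => (`|f x| * (1 + normR x))%:E) < +oo)%E ->
      inLp p (fun x => normR x * f x) ->
      inLp p (fun x => normR x ^+ 2 * f x) ->
      exists (F2 : 'I_(cN G) -> 'I_(cN G) -> pt G -> R)
             (F1 : 'I_(cN G) -> pt G -> R),
        (forall i j, inLp p (F2 i j)) /\
        (forall i : 'I_(cN G), (cn G <= i)%N -> inLp p (F1 i)) /\
        (forall phi : pt G -> R, test_fun phi ->
           intN (fun x => f x * phi x) =
             intN f * phi 0
           + \sum_(i < cN G | (i < cn G)%N)
                intN (fun x => f x * x ord0 i) * Xop i phi 0
           + \sum_i \sum_j intN (fun x => F2 i j x * Xop j (Xop i phi) x)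
           - \sum_(i < cN G | (cn G <= i)%N) intN (fun x => F1 i x * Xop i phi x)) /\
        (forall i j,
           (LpN p (F2 i j) <= C%:E * LpN p (fun x => (normR x ^+ 2 * f x)%R))%E) /\
        (forall i : 'I_(cN G), (cn G <= i)%N ->
           (LpN p (F1 i) <= C%:E * LpN p (fun x => (normR x * f x)%R))%E))
  /\
  (* (ii) Q > 2s and p > Q/(Q-2s) *)
  ((2 * cs G < homdim G)%N ->
   (((homdim G)%:R / ((homdim G)%:R - 2 * (cs G)%:R))%:E < p)%E ->
    exists C : R, 0 < C /\
    forall f : pt G -> R,
      loc_int f ->
      inLp p (fun x => normR x * f x) ->
      inLp p (fun x => normR x ^+ 2 * f x) ->
      exists (F2 : 'I_(cN G) -> 'I_(cN G) -> pt G -> R)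
             (F1 : 'I_(cN G) -> pt G -> R),
        (forall i j, inLp p (F2 i j)) /\
        (forall i : 'I_(cN G), (cn G <= i)%N -> inLp p (F1 i)) /\
        (forall phi : pt G -> R, test_fun phi ->
           intN (fun x => f x * phi x) =
             \sum_i \sum_j intN (fun x => F2 i j x * Xop j (Xop i phi) x)
           - \sum_(i < cN G | (cn G <= i)%N) intN (fun x => F1 i x * Xop i phi x)) /\
        (forall i j,
           (LpN p (F2 i j) <= C%:E * LpN p (fun x => (normR x ^+ 2 * f x)%R))%E) /\
        (forall i : 'I_(cN G), (cn G <= i)%N ->
           (LpN p (F1 i) <= C%:E * LpN p (fun x => (normR x * f x)%R))%E))).
Proof.
split; last exact: decomposition_supercritical.
move=> r pr; rewrite {p}pr lee_fin in hp *; exact: decomposition_subcritical.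
Qed.
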